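(* Let $f(z)=\sum_{n=0}^\infty a_n z^n$ be a quasi-lacunary series with associated index sequence $(m_v)_{v\ge 0}$, and suppose that the sequence of coefficients $(a_{m_v})_{v\ge 0}$ is bounded. Then the sequence of partial sums $s_{m_v}(z)=\sum_{k=0}^{m_v}a_k z^k$, $v=0,1,2,\dots$, converges uniformly on every arc of holomorphy $L\subset\partial\mathbb{E}$ of $f$.
   Context: An infinite complex power series $\sum_{n=0}^\infty a_n z^n$ is called a quasi-lacunary series if there exist an increasing sequence $(m_v)_{v\ge0}$ of non-negative integers and a sequence $(c_j)_{j\ge 0}$ that is $p$-summable for some $p>1$, i.e. $\sum_{j=0}^\infty|c_j|^p<\infty$, such that $\lim_{v\to\infty}(m_{v+1}-m_v)=\infty$ and $|a_j|\le|c_j|$ whenever $m_v<j<m_{v+1}$, $v=0,1,2,\dots$. The sequence $(m_v)$ is the associated index sequence. $\mathbb{E}=\{z\in\mathbb{C}:|z|<1\}$ is the open unit disc. An arc of holomorphy of $f$ is a closed circular arc $L\subset\partial\mathbb{E}$ such that no point of $L$ is a singular point of $f$, i.e. $f$ extends holomorphically from $\mathbb{E}$ to a neighbourhood of $\mathbb{E}\cup L$. *)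

(* Defs.v *)
From Stdlib Require Import Reals.
From Coquelicot Require Import Coquelicot.
Open Scope R_scope.

(* x^p for x >= 0 and p > 0.  [Rpower 0 p] is 1, because Stdlib sets ln 0 = 0. *)
Definition nnpow (x p : R) : R :=
  if Req_EM_T x 0 then 0 else Rpower x p.

Definition p_summable (p : R) (c : nat -> C) : Prop :=
  ex_series (fun j => nnpow (Cmod (c j)) p).

Definition quasi_lacunary (a : nat -> C) (m : nat -> nat) : Prop :=
  (forall v, (m v <= m (S v))%nat) /\
  is_lim_seq (fun v => INR (m (S v)) - INR (m v)) p_infty /\
  exists (p : R) (c : nat -> C),
    1 < p /\ p_summable p c /\
    forall v j, (m v < j < m (S v))%nat -> Cmod (a j) <= Cmod (c j).

Definition partial_sum (a : nat -> C) (n : nat) (z : C) : C :=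
  sum_n (fun k => (a k * z ^ k)%C) n.

Definition unit_disc (z : C) : Prop := Cmod z < 1.

Definition is_power_series_sum (a : nat -> C) (f : C -> C) : Prop :=
  forall z, unit_disc z ->
    is_series (K := C_AbsRing) (V := C_NormedModule)
      (fun n => (a n * z ^ n)%C) (f z).

(* The whole circle (beta = alpha + 2 PI) and single points are included. *)
Definition closed_circular_arc (L : C -> Prop) : Prop :=
  exists alpha beta : R, alpha <= beta <= alpha + 2 * PI /\
    forall z, L z <->
      exists t : R, alpha <= t <= beta /\ z = (cos t, sin t).

Definition holomorphic_on (U : C -> Prop) (g : C -> C) : Prop :=
  open (T := C_UniformSpace) U /\
  forall z, U z -> ex_derive (K := C_AbsRing) (V := C_NormedModule) g z.

(* Only the values of f in the unit disc matter. *)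
Definition arc_of_holomorphy (f : C -> C) (L : C -> Prop) : Prop :=
  closed_circular_arc L /\
  exists (U : C -> Prop) (g : C -> C),
    (forall z, unit_disc z \/ L z -> U z) /\
    holomorphic_on U g /\
    (forall z, unit_disc z -> g z = f z).

Definition converges_uniformly_on (L : C -> Prop) (u : nat -> C -> C) : Prop :=
  exists s : C -> C, forall eps : R, 0 < eps ->
    exists N : nat, forall v : nat, (N <= v)%nat ->
      forall z, L z -> Cmod (u v z - s z)%C < eps.

(* Main.v *)
(* Rotate so that the point of the arc under study is [1], put [n = m_v] and consider the remainder [(g z - s_n z) z^-(n+1+N) P z] on the boundary of a rectangle around [1] that crosses the unit circle twice, where [P] has double zeros at the two crossings. Since the coefficients are bounded, outside the disc this is at most a constant times [(|z| - 1) |z|^-N <= 1/N]. Inside the disc only coefficients of index greater than [n] enter: the first [J] of them lie in the gap after [m_v] and are small, the others contribute at most a constant times [(1 - |z|) |z|^J <= 1/J], up to a factor [2^N]. Choosing first [N], then [J], then [v] makes the remainder small on the whole boundary, hence at [1] by Cauchy's formula. The bounds do not depend on the rotation, and compactness of the arc does the rest. *)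

Require Import Defs.
From Stdlib Require Import Reals Lra Lia ClassicalEpsilon.
From Coquelicot Require Import Coquelicot.
Open Scope R_scope.

(** * Complex continuity and differentiability *)

(** The zeros of the weight are double because near the unit circle the remainder is controlled only
    up to [1 / | |z| - 1 |]: one order cancels this growth, the other leaves a factor [|z| - 1] for
    the powers [|z|^-N] and [|z|^J] to beat. An axis-parallel rectangle is used because its contour
    integral reduces to real Riemann integrals of components. Differentiability is given pointwise,
    without continuity of the derivative, so Cauchy's theorem has to come from Goursat's
    subdivision. Cauchy's formula serves only as an estimate at one interior point; the value
    [2 pi i] of the integral of [1 / (z - p)] is therefore never computed, and its being nonzero is
    enough. *)

Lemma Cmod_le_sum_components (z : C) : Cmod z <= Rabs (fst z) + Rabs (snd z).
Proof.
  destruct z as [x y]; simpl.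
  replace (x, y) with (x + Ci * y)%C
    by (unfold Ci, Cplus, Cmult, RtoC; simpl; f_equal; ring).
  eapply Rle_trans; [apply Cmod_triangle|].
  rewrite Cmod_mult, Cmod_Ci, !Cmod_R; lra.
Qed.

Lemma Rabs_fst_le_Cmod (z : C) : Rabs (fst z) <= Cmod z.
Proof. exact (Rle_trans _ _ _ (Rmax_l _ _) (Rmax_Cmod z)). Qed.

Lemma Rabs_snd_le_Cmod (z : C) : Rabs (snd z) <= Cmod z.
Proof. exact (Rle_trans _ _ _ (Rmax_r _ _) (Rmax_Cmod z)). Qed.

Lemma Cmod_sub_sym (z w : C) : Cmod (z - w) = Cmod (w - z).
Proof. rewrite <- Cmod_opp; f_equal; ring. Qed.

(* In Coquelicot's filter lemmas bound variables have type [UniformSpace.sort C_UniformSpace], on which [ring] and [field] find no structure. *)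
Ltac C_carrier :=
  cbv beta;
  repeat match goal with w : UniformSpace.sort C_UniformSpace |- _ => change C in (type of w) end;
  match goal with |- @eq _ ?x ?y => change (@eq C x y) end.
Ltac C_ring := C_carrier; ring.
Ltac C_field := C_carrier; field.

Notation C_continuous := (continuous (T := C_UniformSpace) (U := C_UniformSpace)).

(** Balls of [C_UniformSpace] are squares. A disc lies in the square of the same radius, and the
    square of half the radius lies in the disc. *)
Lemma locally_C (z : C) (P : C -> Prop) :
  locally (T := C_UniformSpace) z P <->
  exists d, 0 < d /\ forall w, Cmod (w - z) < d -> P w.
Proof.
  split.
  - intros [d H]; exists d; split; [apply cond_pos|].
    intros w Hw; apply H; split; simpl.
    + exact (Rle_lt_trans _ _ _ (Rabs_fst_le_Cmod (w - z)%C) Hw).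
    + exact (Rle_lt_trans _ _ _ (Rabs_snd_le_Cmod (w - z)%C) Hw).
  - intros (d & Hd & H).
    assert (Hd2 : 0 < d / 2) by lra.
    exists (mkposreal _ Hd2); intros w [H1 H2]; apply H.
    eapply Rle_lt_trans; [apply Cmod_le_sum_components|].
    change (Rabs (fst w - fst z) < d / 2) in H1.
    change (Rabs (snd w - snd z) < d / 2) in H2.
    simpl; unfold Rminus in *; lra.
Qed.

Lemma C_continuous_eps (f : C -> C) (z : C) :
  C_continuous f z <->
  forall e, 0 < e -> exists d, 0 < d /\
    forall w, Cmod (w - z) < d -> Cmod (f w - f z) < e.
Proof.
  split.
  - intros H e He.
    apply (locally_C z (fun w => Cmod (f w - f z) < e)).
    apply (H (fun y => Cmod (y - f z) < e)).
    apply locally_C; exists e; auto.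
  - intros H P HP.
    apply locally_C in HP; destruct HP as (e & He & HP).
    destruct (H e He) as (d & Hd & Hw).
    apply locally_C; exists d; auto.
Qed.

Lemma C_continuous_const (c z : C) : C_continuous (fun _ => c) z.
Proof. apply continuous_const. Qed.

Lemma C_continuous_plus (f g : C -> C) (z : C) :
  C_continuous f z -> C_continuous g z ->
  C_continuous (fun w => (f w + g w)%C) z.
Proof.
  exact (@continuous_plus C_UniformSpace R_AbsRing C_R_NormedModule f g z).
Qed.

Lemma C_continuous_components (f : C -> C) (z : C) :
  C_continuous f z <->
  continuous (T := C_UniformSpace) (U := R_UniformSpace) (fun w => fst (f w)) z /\
  continuous (T := C_UniformSpace) (U := R_UniformSpace) (fun w => snd (f w)) z.
Proof.
  split.
  - intros H; split.
    + apply (continuous_comp f fst z H); destruct (f z); apply continuous_fst.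
    + apply (continuous_comp f snd z H); destruct (f z); apply continuous_snd.
  - intros [H1 H2] P [e HP].
    assert (A1 : locally (T := C_UniformSpace) z (fun w => ball (fst (f z)) e (fst (f w))))
      by exact (H1 _ (locally_ball (fst (f z)) e)).
    assert (A2 : locally (T := C_UniformSpace) z (fun w => ball (snd (f z)) e (snd (f w))))
      by exact (H2 _ (locally_ball (snd (f z)) e)).
    generalize (filter_and _ _ A1 A2).
    apply (filter_imp (F := locally (T := C_UniformSpace) z)); intros w [B1 B2]; apply HP; split; assumption.
Qed.

Lemma C_continuous_mult (f g : C -> C) (z : C) :
  C_continuous f z -> C_continuous g z ->
  C_continuous (fun w => (f w * g w)%C) z.
Proof.
  intros Hf Hg.
  apply C_continuous_components in Hf; destruct Hf as [Hf1 Hf2].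
  apply C_continuous_components in Hg; destruct Hg as [Hg1 Hg2].
  apply C_continuous_components; split.
  - apply (continuous_minus (V := R_NormedModule)); apply (continuous_mult (K := R_AbsRing)); assumption.
  - apply (continuous_plus (V := R_NormedModule)); apply (continuous_mult (K := R_AbsRing)); assumption.
Qed.

Lemma C_continuous_inv (z : C) : z <> 0%C -> C_continuous Cinv z.
Proof.
  intros Hz.
  assert (N : fst z ^ 2 + snd z ^ 2 <> 0).
  { intros E; apply Hz; destruct z as [x y]; simpl in E.
    unfold RtoC; f_equal; nra. }
  assert (D : continuous (T := C_UniformSpace) (U := R_UniformSpace)
                (fun w => / (fst w ^ 2 + snd w ^ 2)) z).
  { apply (continuous_comp (fun w : C_UniformSpace => fst w ^ 2 + snd w ^ 2 : R_UniformSpace) Rinv).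
    - apply (continuous_plus (V := R_NormedModule)).
      + apply (continuous_comp fst (fun x => x ^ 2)); [destruct z; apply continuous_fst|].
        apply (ex_derive_continuous (V := R_NormedModule)); auto_derive; auto.
      + apply (continuous_comp snd (fun x => x ^ 2)); [destruct z; apply continuous_snd|].
        apply (ex_derive_continuous (V := R_NormedModule)); auto_derive; auto.
    - apply continuous_Rinv; exact N. }
  apply C_continuous_components; split.
  - apply (continuous_mult (K := R_AbsRing) (fun w => fst w)); [destruct z; apply continuous_fst|exact D].
  - apply (continuous_mult (K := R_AbsRing) (fun w => - snd w)); [|exact D].
    apply (continuous_opp (V := R_NormedModule)); destruct z; apply continuous_snd.
Qed.

(* Caratheodory's form of differentiability: [phi] is the difference quotient, its value at [z] the derivative. *)
Definition C_differentiable (f : C -> C) (z : C) : Prop :=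
  exists phi : C -> C, C_continuous phi z /\
    locally (T := C_UniformSpace) z (fun w => f w = (f z + phi w * (w - z))%C).

Lemma C_differentiable_continuous (f : C -> C) (z : C) :
  C_differentiable f z -> C_continuous f z.
Proof.
  intros (phi & Hphi & E).
  apply (continuous_ext_loc _ (fun w => f z + phi w * (w - z))%C).
  - revert E; apply filter_imp; auto.
  - apply C_continuous_plus; [apply C_continuous_const|].
    apply C_continuous_mult; [exact Hphi|].
    apply C_continuous_plus; [apply continuous_id|apply C_continuous_const].
Qed.

Lemma C_differentiable_ext_loc (f g : C -> C) (z : C) :
  locally (T := C_UniformSpace) z (fun w => f w = g w) ->
  C_differentiable f z -> C_differentiable g z.
Proof.
  intros E (phi & Hphi & Ef); exists phi; split; [exact Hphi|].
  pose proof (locally_singleton _ _ E) as Ez; simpl in Ez.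
  generalize (filter_and _ _ E Ef); apply filter_imp; intros w [E1 E2].
  rewrite <- E1, <- Ez; exact E2.
Qed.

Lemma C_differentiable_const (c z : C) : C_differentiable (fun _ => c) z.
Proof.
  exists (fun _ => 0%C); split; [apply C_continuous_const|].
  apply filter_forall; intros w; C_ring.
Qed.

Lemma C_differentiable_id (z : C) : C_differentiable (fun w => w) z.
Proof.
  exists (fun _ => 1%C); split; [apply C_continuous_const|].
  apply filter_forall; intros w; C_ring.
Qed.

Lemma C_differentiable_plus (f g : C -> C) (z : C) :
  C_differentiable f z -> C_differentiable g z ->
  C_differentiable (fun w => (f w + g w)%C) z.
Proof.
  intros (phi & Hphi & Ef) (psi & Hpsi & Eg).
  exists (fun w => phi w + psi w)%C; split; [apply C_continuous_plus; assumption|].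
  generalize (filter_and _ _ Ef Eg); apply filter_imp; intros w [E1 E2].
  rewrite E1, E2; C_ring.
Qed.

Lemma C_differentiable_mult (f g : C -> C) (z : C) :
  C_differentiable f z -> C_differentiable g z ->
  C_differentiable (fun w => (f w * g w)%C) z.
Proof.
  intros Df Dg; pose proof (C_differentiable_continuous f z Df) as Cf.
  destruct Df as (phi & Hphi & Ef), Dg as (psi & Hpsi & Eg).
  exists (fun w => phi w * g z + f w * psi w)%C; split.
  - apply C_continuous_plus; apply C_continuous_mult; try assumption.
    apply C_continuous_const.
  - generalize (filter_and _ _ Ef Eg); apply filter_imp; intros w [E1 E2].
    rewrite E2, E1; C_ring.
Qed.

Lemma C_differentiable_minus (f g : C -> C) (z : C) :
  C_differentiable f z -> C_differentiable g z ->
  C_differentiable (fun w => (f w - g w)%C) z.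
Proof.
  intros Df Dg.
  apply (C_differentiable_ext_loc (fun w => f w + (- (1)) * g w)%C).
  - apply filter_forall; intros w; C_ring.
  - apply C_differentiable_plus; [exact Df|].
    apply C_differentiable_mult; [apply C_differentiable_const|exact Dg].
Qed.

Lemma C_differentiable_pow (f : C -> C) (n : nat) (z : C) :
  C_differentiable f z -> C_differentiable (fun w => (f w ^ n)%C) z.
Proof.
  intros D; induction n as [|n IH]; simpl.
  - apply C_differentiable_const.
  - apply C_differentiable_mult; assumption.
Qed.

Lemma C_nonzero_locally (z : C) :
  z <> 0%C -> locally (T := C_UniformSpace) z (fun w : C => w <> 0%C).
Proof.
  intros Hz; apply locally_C; exists (Cmod z); split; [apply Cmod_gt_0; exact Hz|].
  intros w Hw E; rewrite E in Hw.
  replace (0 - z)%C with (- z)%C in Hw by C_ring; rewrite Cmod_opp in Hw; lra.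
Qed.

Lemma C_differentiable_inv (z : C) : z <> 0%C -> C_differentiable Cinv z.
Proof.
  intros Hz; exists (fun w => - / z * / w)%C; split.
  - apply C_continuous_mult; [apply C_continuous_const|apply C_continuous_inv; exact Hz].
  - generalize (C_nonzero_locally z Hz); apply filter_imp; intros w Hw.
    C_field; split; assumption.
Qed.

(** Caratheodory's form needs no division by [g w - g z], which may vanish arbitrarily close to
    [z]. *)
Lemma C_differentiable_comp (f g : C -> C) (z : C) :
  C_differentiable g z -> C_differentiable f (g z) ->
  C_differentiable (fun w => f (g w)) z.
Proof.
  intros Dg; pose proof (C_differentiable_continuous g z Dg) as Cg.
  destruct Dg as (psi & Hpsi & Eg); intros (phi & Hphi & Ef).
  exists (fun w => phi (g w) * psi w)%C; split.
  - apply C_continuous_mult; [|exact Hpsi].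
    apply (continuous_comp g phi); assumption.
  - assert (Efg : locally (T := C_UniformSpace) z
      (fun w => f (g w) = (f (g z) + phi (g w) * (g w - g z))%C)) by exact (Cg _ Ef).
    generalize (filter_and _ _ Efg Eg).
    apply (filter_imp (F := locally (T := C_UniformSpace) z)); intros w [E1 E2].
    rewrite E1; replace (g w - g z)%C with (psi w * (w - z))%C by (rewrite E2; C_ring).
    C_ring.
Qed.

Lemma ex_derive_C_differentiable (f : C -> C) (z : C) :
  ex_derive (K := C_AbsRing) (V := C_NormedModule) f z -> C_differentiable f z.
Proof.
  intros [l [_ H]]; change C in (type of l).
  specialize (H z (fun P HP => HP)).
  exists (fun w => if Ceq_dec w z then l else ((f w - f z) / (w - z))%C); split.
  - apply C_continuous_eps; intros e He.
    (* The little-o of [is_derive] is a weak inequality; halving [e] makes the final one strict. *)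
    assert (He2 : 0 < e / 2) by lra.
    destruct (H (mkposreal _ He2)) as [d Hd].
    exists d; split; [apply cond_pos|]; intros w Hw.
    destruct (Ceq_dec z z) as [_|N]; [|now elim N].
    destruct (Ceq_dec w z) as [->|N].
    { replace (l - l)%C with (RtoC 0) by C_ring; rewrite Cmod_0; exact He. }
    specialize (Hd w Hw).
    change (Cmod ((f w - f z) - (w - z) * l)%C <= e / 2 * Cmod (w - z)%C) in Hd.
    assert (Nz : (w - z)%C <> 0%C).
    { intros E; apply N; replace w with (w - z + z)%C by C_ring; rewrite E; C_ring. }
    pose proof (proj1 (Cmod_gt_0 _) Nz) as P.
    replace ((f w - f z) / (w - z) - l)%C
      with ((f w - f z - (w - z) * l) / (w - z))%C by (C_field; exact Nz).
    rewrite Cmod_div by exact Nz.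
    apply Rmult_lt_reg_r with (Cmod (w - z)); [exact P|].
    unfold Rdiv; rewrite Rmult_assoc, Rinv_l by lra; nra.
  - apply filter_forall; intros w.
    destruct (Ceq_dec w z) as [->|N]; [C_ring|].
    C_field; intros E; apply N; replace w with (w - z + z)%C by C_ring; rewrite E; C_ring.
Qed.

Lemma C_differentiable_partial_sum (a : nat -> C) (n : nat) (z : C) :
  C_differentiable (partial_sum a n) z.
Proof.
  assert (M : forall k, C_differentiable (fun w => (a k * w ^ k)%C) z).
  { intros k; apply C_differentiable_mult; [apply C_differentiable_const|].
    apply C_differentiable_pow, C_differentiable_id. }
  unfold partial_sum; induction n as [|n IH].
  - apply (C_differentiable_ext_loc (fun w => a O * w ^ O)%C); [|apply M].
    apply filter_forall; intros w; rewrite sum_O; reflexivity.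
  - apply (C_differentiable_ext_loc
      (fun w => sum_n (fun k => a k * w ^ k)%C n + a (S n) * w ^ (S n))%C).
    + apply filter_forall; intros w; rewrite sum_Sn; reflexivity.
    + apply C_differentiable_plus; [exact IH|apply M].
Qed.

(** * Integrals along the boundary of a rectangle *)

Ltac R_ring := match goal with |- @eq _ ?x ?y => change (@eq R x y) end; ring.

Definition C_integrable (f : R -> C) (a b : R) : Prop :=
  ex_RInt (fun t => fst (f t)) a b /\ ex_RInt (fun t => snd (f t)) a b.

Definition C_int (f : R -> C) (a b : R) : C :=
  (RInt (fun t => fst (f t)) a b, RInt (fun t => snd (f t)) a b).

Lemma C_int_Chasles (f : R -> C) (a b c : R) :
  C_integrable f a b -> C_integrable f b c ->
  C_int f a c = (C_int f a b + C_int f b c)%C.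
Proof.
  intros [H1 H2] [H3 H4]; unfold C_int, Cplus; simpl; f_equal; symmetry;
    apply (RInt_Chasles (V := R_CompleteNormedModule)); assumption.
Qed.

Lemma C_int_minus (f g : R -> C) (a b : R) :
  C_integrable f a b -> C_integrable g a b ->
  C_int (fun t => f t - g t)%C a b = (C_int f a b - C_int g a b)%C.
Proof.
  intros [H1 H2] [H3 H4]; unfold C_int, Cminus, Cplus, Copp; simpl; f_equal;
    apply (RInt_minus (V := R_CompleteNormedModule)); assumption.
Qed.

Lemma C_int_scal (k : C) (f : R -> C) (a b : R) :
  C_integrable f a b -> C_int (fun t => k * f t)%C a b = (k * C_int f a b)%C.
Proof.
  assert (S : forall (l : R) (g : R -> R), ex_RInt g a b ->
    ex_RInt (fun t => l * g t) a b /\ RInt (fun t => l * g t) a b = l * RInt g a b).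
  { intros l g Hg; split.
    - exact (ex_RInt_scal (V := R_NormedModule) g a b l Hg).
    - exact (RInt_scal (V := R_CompleteNormedModule) g a b l Hg). }
  intros [H1 H2]; unfold C_int, Cmult; simpl; f_equal.
  - etransitivity.
    + apply (RInt_minus (V := R_CompleteNormedModule)
        (fun t => fst k * fst (f t)) (fun t => snd k * snd (f t))); apply S; assumption.
    + unfold minus, plus, opp; simpl.
      rewrite (proj2 (S (fst k) _ H1)), (proj2 (S (snd k) _ H2)); ring.
  - etransitivity.
    + apply (RInt_plus (V := R_CompleteNormedModule)
        (fun t => fst k * snd (f t)) (fun t => snd k * fst (f t))); apply S; assumption.
    + unfold plus; simpl.
      rewrite (proj2 (S (fst k) _ H2)), (proj2 (S (snd k) _ H1)); ring.
Qed.

Lemma C_int_ext (f g : R -> C) (a b : R) :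
  a <= b -> (forall t, a <= t <= b -> f t = g t) -> C_int f a b = C_int g a b.
Proof.
  intros Hab E; unfold C_int; f_equal; apply RInt_ext; intros t;
    rewrite Rmin_left, Rmax_right by exact Hab; intros Ht; rewrite E; auto; lra.
Qed.

(** The factor 2 comes from bounding the two components separately; constants do not matter
    later. *)
Lemma C_int_bound (f : R -> C) (a b M : R) :
  a <= b -> C_integrable f a b -> (forall t, a <= t <= b -> Cmod (f t) <= M) ->
  Cmod (C_int f a b) <= 2 * M * (b - a).
Proof.
  intros Hab [H1 H2] HM.
  eapply Rle_trans; [apply Cmod_le_sum_components|]; simpl.
  assert (B1 : Rabs (RInt (fun t => fst (f t)) a b) <= (b - a) * M).
  { apply abs_RInt_le_const; [exact Hab|exact H1|].
    intros t Ht; exact (Rle_trans _ _ _ (Rabs_fst_le_Cmod _) (HM t Ht)). }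
  assert (B2 : Rabs (RInt (fun t => snd (f t)) a b) <= (b - a) * M).
  { apply abs_RInt_le_const; [exact Hab|exact H2|].
    intros t Ht; exact (Rle_trans _ _ _ (Rabs_snd_le_Cmod _) (HM t Ht)). }
  lra.
Qed.

Lemma C_int_affine (k l : C) (a b : R) :
  C_int (fun t => k + l * t)%C a b =
  (k * (b - a)%R + l * ((b * b - a * a) / 2)%R)%C.
Proof.
  assert (A : forall u v : R,
    RInt (fun t => u + v * t) a b = u * (b - a) + v * ((b * b - a * a) / 2)).
  { intros u v; apply is_RInt_unique.
    replace (u * (b - a) + v * ((b * b - a * a) / 2))
      with (minus (u * b + v * (b * b) / 2) (u * a + v * (a * a) / 2))
      by (unfold minus, plus, opp; simpl; field).
    apply (is_RInt_derive (V := R_CompleteNormedModule) (fun t => u * t + v * (t * t) / 2)).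
    - intros t _; auto_derive; [exact I|field].
    - intros t _; apply (ex_derive_continuous (V := R_NormedModule)); auto_derive; exact I. }
  destruct k as [k1 k2], l as [l1 l2].
  unfold C_int, Cplus, Cmult, RtoC; simpl; f_equal.
  - rewrite (RInt_ext _ (fun t => k1 + l1 * t)) by (intros; R_ring).
    rewrite A; R_ring.
  - rewrite (RInt_ext _ (fun t => k2 + l2 * t)) by (intros; R_ring).
    rewrite A; R_ring.
Qed.

Definition in_rect (a b c d : R) (z : C) : Prop :=
  a <= fst z <= b /\ c <= snd z <= d.

Definition on_rect_boundary (a b c d : R) (z : C) : Prop :=
  in_rect a b c d z /\ (fst z = a \/ fst z = b \/ snd z = c \/ snd z = d).

(** The counterclockwise contour integral: [dz] is [dx] on the horizontal sides and [Ci * dy] on the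
    vertical ones. *)
Definition rect_int (F : C -> C) (a b c d : R) : C :=
  (C_int (fun x => F (x, c)) a b - C_int (fun x => F (x, d)) a b
   + Ci * (C_int (fun y => F (b, y)) c d - C_int (fun y => F (a, y)) c d))%C.

Definition continuous_on_rect (F : C -> C) (a b c d : R) : Prop :=
  forall z, in_rect a b c d z -> C_continuous F z.

Lemma continuous_on_rect_sub (F : C -> C) (a b c d a' b' c' d' : R) :
  continuous_on_rect F a b c d -> a <= a' -> b' <= b -> c <= c' -> d' <= d ->
  continuous_on_rect F a' b' c' d'.
Proof.
  intros H Ha Hb Hc Hd z [Hx Hy]; apply H; split; lra.
Qed.

Lemma C_integrable_horizontal (F : C -> C) (a b c : R) :
  a <= b -> (forall x, a <= x <= b -> C_continuous F (x, c)) ->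
  C_integrable (fun x => F (x, c)) a b.
Proof.
  intros Hab H.
  assert (L : forall x, continuous (T := R_UniformSpace) (U := C_UniformSpace) (fun x => (x, c)) x).
  { intros x P [e HP]; exists e; intros y Hy; apply HP; split; [exact Hy|apply ball_center]. }
  split; apply (ex_RInt_continuous (V := R_CompleteNormedModule)); intros x;
    rewrite Rmin_left, Rmax_right by exact Hab; intros Hx;
    pose proof (proj1 (C_continuous_components _ _) (H x Hx)) as [K1 K2].
  - apply (continuous_comp (fun x => (x, c) : C_UniformSpace) (fun z => fst (F z) : R_UniformSpace));
      [apply L|exact K1].
  - apply (continuous_comp (fun x => (x, c) : C_UniformSpace) (fun z => snd (F z) : R_UniformSpace));
      [apply L|exact K2].
Qed.

Lemma C_integrable_vertical (F : C -> C) (a c d : R) :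
  c <= d -> (forall y, c <= y <= d -> C_continuous F (a, y)) ->
  C_integrable (fun y => F (a, y)) c d.
Proof.
  intros Hcd H.
  assert (L : forall y, continuous (T := R_UniformSpace) (U := C_UniformSpace) (fun y => (a, y)) y).
  { intros y P [e HP]; exists e; intros x Hx; apply HP; split; [apply ball_center|exact Hx]. }
  split; apply (ex_RInt_continuous (V := R_CompleteNormedModule)); intros y;
    rewrite Rmin_left, Rmax_right by exact Hcd; intros Hy;
    pose proof (proj1 (C_continuous_components _ _) (H y Hy)) as [K1 K2].
  - apply (continuous_comp (fun y => (a, y) : C_UniformSpace) (fun z => fst (F z) : R_UniformSpace));
      [apply L|exact K1].
  - apply (continuous_comp (fun y => (a, y) : C_UniformSpace) (fun z => snd (F z) : R_UniformSpace));
      [apply L|exact K2].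
Qed.

(* Continuity is only required on the boundary, so that the lemmas below also apply to functions with a pole inside. *)
Definition continuous_on_boundary (F : C -> C) (a b c d : R) : Prop :=
  forall z, on_rect_boundary a b c d z -> C_continuous F z.

Lemma continuous_on_rect_boundary (F : C -> C) (a b c d : R) :
  continuous_on_rect F a b c d -> continuous_on_boundary F a b c d.
Proof. intros H z [Hz _]; exact (H z Hz). Qed.

Lemma rect_sides_integrable (F : C -> C) (a b c d : R) :
  a <= b -> c <= d -> continuous_on_boundary F a b c d ->
  (C_integrable (fun x => F (x, c)) a b /\ C_integrable (fun x => F (x, d)) a b) /\
  (C_integrable (fun y => F (a, y)) c d /\ C_integrable (fun y => F (b, y)) c d).
Proof.
  intros Hab Hcd H; split; split.
  1, 2: apply C_integrable_horizontal; [exact Hab|].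
  3, 4: apply C_integrable_vertical; [exact Hcd|].
  all: intros t Ht; apply H; repeat split; simpl; try lra; tauto.
Qed.

Lemma rect_int_split_x (F : C -> C) (a m b c d : R) :
  a <= m <= b -> c <= d -> continuous_on_rect F a b c d ->
  rect_int F a b c d = (rect_int F a m c d + rect_int F m b c d)%C.
Proof.
  intros Hm Hcd H; unfold rect_int.
  rewrite (C_int_Chasles (fun x => F (x, c)) a m b), (C_int_Chasles (fun x => F (x, d)) a m b).
  1: ring.
  all: apply C_integrable_horizontal; [lra|]; intros x Hx; apply H; split; simpl; lra.
Qed.

Lemma rect_int_split_y (F : C -> C) (a b c m d : R) :
  a <= b -> c <= m <= d -> continuous_on_rect F a b c d ->
  rect_int F a b c d = (rect_int F a b c m + rect_int F a b m d)%C.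
Proof.
  intros Hab Hm H; unfold rect_int.
  rewrite (C_int_Chasles (fun y => F (a, y)) c m d), (C_int_Chasles (fun y => F (b, y)) c m d).
  1: ring.
  all: apply C_integrable_vertical; [lra|]; intros x Hx; apply H; split; simpl; lra.
Qed.

Lemma rect_int_bound (F : C -> C) (a b c d M : R) :
  a <= b -> c <= d -> continuous_on_boundary F a b c d ->
  (forall z, on_rect_boundary a b c d z -> Cmod (F z) <= M) ->
  Cmod (rect_int F a b c d) <= 4 * M * ((b - a) + (d - c)).
Proof.
  intros Hab Hcd HF HM.
  destruct (rect_sides_integrable F a b c d Hab Hcd HF) as [[I1 I2] [I3 I4]].
  assert (B1 : Cmod (C_int (fun x => F (x, c)) a b) <= 2 * M * (b - a)).
  { apply C_int_bound; auto; intros t Ht; apply HM; repeat split; simpl; try lra; tauto. }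
  assert (B2 : Cmod (C_int (fun x => F (x, d)) a b) <= 2 * M * (b - a)).
  { apply C_int_bound; auto; intros t Ht; apply HM; repeat split; simpl; try lra; tauto. }
  assert (B3 : Cmod (C_int (fun y => F (a, y)) c d) <= 2 * M * (d - c)).
  { apply C_int_bound; auto; intros t Ht; apply HM; repeat split; simpl; try lra; tauto. }
  assert (B4 : Cmod (C_int (fun y => F (b, y)) c d) <= 2 * M * (d - c)).
  { apply C_int_bound; auto; intros t Ht; apply HM; repeat split; simpl; try lra; tauto. }
  unfold rect_int.
  eapply Rle_trans; [apply Cmod_triangle|]; rewrite Cmod_mult, Cmod_Ci, Rmult_1_l.
  unfold Cminus.
  pose proof (Cmod_triangle (C_int (fun x => F (x, c)) a b) (- C_int (fun x => F (x, d)) a b)) as T1.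
  pose proof (Cmod_triangle (C_int (fun y => F (b, y)) c d) (- C_int (fun y => F (a, y)) c d)) as T2.
  rewrite Cmod_opp in T1, T2; lra.
Qed.

Lemma rect_int_minus (F G : C -> C) (a b c d : R) :
  a <= b -> c <= d -> continuous_on_boundary F a b c d -> continuous_on_boundary G a b c d ->
  rect_int (fun z => F z - G z)%C a b c d = (rect_int F a b c d - rect_int G a b c d)%C.
Proof.
  intros Hab Hcd HF HG.
  destruct (rect_sides_integrable F a b c d Hab Hcd HF) as [[I1 I2] [I3 I4]].
  destruct (rect_sides_integrable G a b c d Hab Hcd HG) as [[J1 J2] [J3 J4]].
  unfold rect_int.
  rewrite (C_int_minus (fun x => F (x, c))), (C_int_minus (fun x => F (x, d))),
    (C_int_minus (fun y => F (a, y))), (C_int_minus (fun y => F (b, y))) by assumption.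
  ring.
Qed.

Lemma rect_int_scal (k : C) (F : C -> C) (a b c d : R) :
  a <= b -> c <= d -> continuous_on_boundary F a b c d ->
  rect_int (fun z => k * F z)%C a b c d = (k * rect_int F a b c d)%C.
Proof.
  intros Hab Hcd HF.
  destruct (rect_sides_integrable F a b c d Hab Hcd HF) as [[I1 I2] [I3 I4]].
  unfold rect_int.
  rewrite (C_int_scal k (fun x => F (x, c))), (C_int_scal k (fun x => F (x, d))),
    (C_int_scal k (fun y => F (a, y))), (C_int_scal k (fun y => F (b, y))) by assumption.
  ring.
Qed.

Lemma rect_int_ext (F G : C -> C) (a b c d : R) :
  a <= b -> c <= d -> (forall z, on_rect_boundary a b c d z -> F z = G z) ->
  rect_int F a b c d = rect_int G a b c d.
Proof.
  intros Hab Hcd E; unfold rect_int.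
  rewrite (C_int_ext (fun x => F (x, c)) (fun x => G (x, c))),
    (C_int_ext (fun x => F (x, d)) (fun x => G (x, d))),
    (C_int_ext (fun y => F (a, y)) (fun y => G (a, y))),
    (C_int_ext (fun y => F (b, y)) (fun y => G (b, y))); auto;
    intros t Ht; apply E; repeat split; simpl; try lra; tauto.
Qed.

(** Cauchy's theorem by direct computation for the functions that Goursat's argument subtracts. *)
Lemma rect_int_affine (k l : C) (a b c d : R) :
  rect_int (fun z => k + l * z)%C a b c d = 0%C.
Proof.
  unfold rect_int.
  assert (H : forall y, C_int (fun x => k + l * (x, y))%C a b
    = C_int (fun x => (k + l * (0%R, y)) + l * x)%C a b).
  { intros y; unfold C_int; f_equal; apply RInt_ext; intros x _; simpl; R_ring. }
  assert (V : forall x, C_int (fun y => k + l * (x, y))%C c d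
    = C_int (fun y => (k + l * x) + (l * Ci) * y)%C c d).
  { intros x; unfold C_int; f_equal; apply RInt_ext; intros y _; simpl; R_ring. }
  rewrite !H, !V, !C_int_affine.
  destruct k as [k1 k2], l as [l1 l2].
  apply injective_projections; simpl; field.
Qed.

(** * Goursat's theorem *)

(** The intervals [[u n, u n + w / 2 ^ n]] are nested, so the supremum of their left ends lies in
    all of them. *)
Lemma nested_halving (u : nat -> R) (w : R) :
  0 <= w ->
  (forall n, u n <= u (S n) <= u n + w / 2 ^ S n) ->
  exists l, forall n, u n <= l <= u n + w / 2 ^ n.
Proof.
  intros Hw H.
  assert (P2 : forall n, 0 < 2 ^ n) by (intros n; apply pow_lt; lra).
  assert (Pw : forall n, 0 <= w / 2 ^ n).
  { intros n; apply Rmult_le_pos; [exact Hw|]; left; apply Rinv_0_lt_compat, P2. }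
  assert (Hs : forall n, u (S n) + w / 2 ^ S n <= u n + w / 2 ^ n).
  { intros n; replace (w / 2 ^ n) with (w / 2 ^ S n + w / 2 ^ S n)
      by (simpl; field; apply Rgt_not_eq, P2).
    specialize (H n); lra. }
  assert (Hk : forall n k, u n <= u (n + k)%nat /\
    u (n + k)%nat + w / 2 ^ (n + k) <= u n + w / 2 ^ n).
  { intros n k; induction k as [|k IH].
    - rewrite Nat.add_0_r; lra.
    - rewrite Nat.add_succ_r; specialize (H (n + k)%nat); specialize (Hs (n + k)%nat); lra. }
  assert (B : forall n m, u m <= u n + w / 2 ^ n).
  { intros n m; destruct (Nat.le_ge_cases n m) as [L|L].
    - replace m with (n + (m - n))%nat by lia.
      pose proof (Hk n (m - n)%nat); specialize (Pw (n + (m - n))%nat); lra.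
    - replace n with (m + (n - m))%nat by lia.
      pose proof (Hk m (n - m)%nat); specialize (Pw (m + (n - m))%nat); lra. }
  destruct (completeness (fun x => exists n, x = u n)) as [l [U L]].
  - exists (u O + w / 2 ^ 0); intros x [n ->]; apply B.
  - exists (u O), O; reflexivity.
  - exists l; intros n; split.
    + apply U; exists n; reflexivity.
    + apply L; intros x [m ->]; apply B.
Qed.

(** Three comparisons decide which quarter of a rectangle to keep: if they all fail, the fourth
    piece must carry a quarter of the integral. *)
Lemma quarter_of_sum (z0 z1 z2 z3 z4 : C) :
  z0 = (z1 + z2 + z3 + z4)%C ->
  Cmod z1 < Cmod z0 / 4 -> Cmod z2 < Cmod z0 / 4 -> Cmod z3 < Cmod z0 / 4 ->
  Cmod z0 <= 4 * Cmod z4.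
Proof.
  intros E H1 H2 H3.
  pose proof (Cmod_triangle (z1 + z2 + z3) z4).
  pose proof (Cmod_triangle (z1 + z2) z3).
  pose proof (Cmod_triangle z1 z2).
  rewrite E in *; lra.
Qed.

Section Goursat.

Variables (F : C -> C) (w h : R).
Hypotheses (w_ge0 : 0 <= w) (h_ge0 : 0 <= h).

(** All rectangles of the subdivision are similar to the first, so a lower left corner and a scale
    describe them. *)
Let I (p : C) (s : R) : C :=
  rect_int F (fst p) (fst p + s * w) (snd p) (snd p + s * h).

(** The result is a [sig] so that a fixpoint can iterate it. Continuity is a premise inside the
    specification, because the corners are chosen before the smaller rectangles are known to stay in
    the first one. *)
Lemma goursat_step (p : C) (s : R) : 0 <= s ->
  { q : C |
    fst p <= fst q <= fst p + s / 2 * w /\ snd p <= snd q <= snd p + s / 2 * h /\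
    (continuous_on_rect F (fst p) (fst p + s * w) (snd p) (snd p + s * h) ->
     Cmod (I p s) <= 4 * Cmod (I q (s / 2))) }.
Proof.
  intros Hs.
  assert (Pw : 0 <= s / 2 * w) by (apply Rmult_le_pos; lra).
  assert (Ph : 0 <= s / 2 * h) by (apply Rmult_le_pos; lra).
  set (q2 := (fst p + s / 2 * w, snd p) : C).
  set (q3 := (fst p, snd p + s / 2 * h) : C).
  set (q4 := (fst p + s / 2 * w, snd p + s / 2 * h) : C).
  assert (E : continuous_on_rect F (fst p) (fst p + s * w) (snd p) (snd p + s * h) ->
    I p s = (I p (s / 2) + I q2 (s / 2) + I q3 (s / 2) + I q4 (s / 2))%C).
  { intros HF; unfold I, q2, q3, q4; simpl.
    replace (fst p + s / 2 * w + s / 2 * w) with (fst p + s * w) by field.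
    replace (snd p + s / 2 * h + s / 2 * h) with (snd p + s * h) by field.
    rewrite (rect_int_split_x F _ (fst p + s / 2 * w)) by (try lra; exact HF).
    rewrite (rect_int_split_y F (fst p) _ _ (snd p + s / 2 * h));
      [|lra|lra|apply (continuous_on_rect_sub _ _ _ _ _ _ _ _ _ HF); lra].
    rewrite (rect_int_split_y F (fst p + s / 2 * w) _ _ (snd p + s / 2 * h));
      [|lra|lra|apply (continuous_on_rect_sub _ _ _ _ _ _ _ _ _ HF); lra].
    ring. }
  destruct (Rlt_le_dec (Cmod (I p (s / 2))) (Cmod (I p s) / 4)) as [L1|L1];
    [|exists p; repeat split; try lra; intros _; lra].
  destruct (Rlt_le_dec (Cmod (I q2 (s / 2))) (Cmod (I p s) / 4)) as [L2|L2];
    [|exists q2; repeat split; simpl; try lra; intros _; lra].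
  destruct (Rlt_le_dec (Cmod (I q3 (s / 2))) (Cmod (I p s) / 4)) as [L3|L3];
    [|exists q3; repeat split; simpl; try lra; intros _; lra].
  exists q4; repeat split; simpl; try lra.
  intros HF; exact (quarter_of_sum _ _ _ _ _ (E HF) L1 L2 L3).
Qed.

Lemma goursat_corners (p0 : C) :
  continuous_on_rect F (fst p0) (fst p0 + w) (snd p0) (snd p0 + h) ->
  exists p : nat -> C, forall n,
    fst p0 <= fst (p n) /\ fst (p n) + / 2 ^ n * w <= fst p0 + w /\
    snd p0 <= snd (p n) /\ snd (p n) + / 2 ^ n * h <= snd p0 + h /\
    fst (p n) <= fst (p (S n)) <= fst (p n) + w / 2 ^ S n /\
    snd (p n) <= snd (p (S n)) <= snd (p n) + h / 2 ^ S n /\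
    Cmod (I p0 1) <= 4 ^ n * Cmod (I (p n) (/ 2 ^ n)).
Proof.
  intros HF.
  assert (P2 : forall n, 0 < 2 ^ n) by (intros n; apply pow_lt; lra).
  assert (Hs : forall n, 0 <= / 2 ^ n) by (intros n; left; apply Rinv_0_lt_compat, P2).
  assert (Half : forall n, / 2 ^ n / 2 = / 2 ^ S n)
    by (intros n; simpl; field; apply Rgt_not_eq, P2).
  set (p := fix p (n : nat) : C :=
    match n with O => p0 | S k => proj1_sig (goursat_step (p k) (/ 2 ^ k) (Hs k)) end).
  assert (Hstep : forall n,
    fst (p n) <= fst (p (S n)) <= fst (p n) + w / 2 ^ S n /\
    snd (p n) <= snd (p (S n)) <= snd (p n) + h / 2 ^ S n /\
    (continuous_on_rect F (fst (p n)) (fst (p n) + / 2 ^ n * w) (snd (p n)) (snd (p n) + / 2 ^ n * h) ->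
     Cmod (I (p n) (/ 2 ^ n)) <= 4 * Cmod (I (p (S n)) (/ 2 ^ S n)))).
  { intros n.
    change (p (S n)) with (proj1_sig (goursat_step (p n) (/ 2 ^ n) (Hs n))).
    destruct (goursat_step (p n) (/ 2 ^ n) (Hs n)) as (q & Q1 & Q2 & Q3); cbn [proj1_sig].
    rewrite Half in Q1, Q2, Q3; unfold Rdiv.
    rewrite (Rmult_comm w), (Rmult_comm h); auto. }
  (* Only this containment discharges the continuity premise in [Hstep], hence a separate induction
     before the one on the integrals. *)
  assert (Hbounds : forall n,
    fst p0 <= fst (p n) /\ fst (p n) + / 2 ^ n * w <= fst p0 + w /\
    snd p0 <= snd (p n) /\ snd (p n) + / 2 ^ n * h <= snd p0 + h).
  { induction n as [|n IH].
    - simpl; rewrite Rinv_1; lra.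
    - destruct (Hstep n) as (S1 & S2 & _).
      rewrite <- !Half in *.
      replace (w / 2 ^ S n) with (/ 2 ^ n / 2 * w) in S1 by (rewrite Half; field; apply Rgt_not_eq, P2).
      replace (h / 2 ^ S n) with (/ 2 ^ n / 2 * h) in S2 by (rewrite Half; field; apply Rgt_not_eq, P2).
      lra. }
  exists p; intros n.
  destruct (Hbounds n) as (B1 & B2 & B3 & B4), (Hstep n) as (S1 & S2 & _).
  repeat split; try assumption; try apply S1; try apply S2.
  clear - Hbounds Hstep HF.
  induction n as [|n IH].
  - simpl; rewrite Rinv_1; unfold p; lra.
  - destruct (Hstep n) as (_ & _ & S3), (Hbounds n) as (B1 & B2 & B3 & B4).
    assert (HFn : continuous_on_rect F (fst (p n)) (fst (p n) + / 2 ^ n * w)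
                    (snd (p n)) (snd (p n) + / 2 ^ n * h))
      by (apply (continuous_on_rect_sub _ _ _ _ _ _ _ _ _ HF); assumption).
    specialize (S3 HFn).
    assert (P4 : 0 < 4 ^ n) by (apply pow_lt; lra).
    eapply Rle_trans; [exact IH|].
    replace (4 ^ S n) with (4 ^ n * 4) by (simpl; ring).
    rewrite Rmult_assoc; apply Rmult_le_compat_l; [lra|exact S3].
Qed.

End Goursat.

Lemma pow2_large (x : R) : exists n, x < 2 ^ n.
Proof.
  destruct (Pow_x_infinity 2 ltac:(rewrite Rabs_pos_eq; lra) (x + 1)) as [n H].
  exists n; specialize (H n (Nat.le_refl n)).
  rewrite Rabs_pos_eq in H by (apply pow_le; lra); lra.
Qed.

(** At the point [zs] common to all the rectangles, [F] is affine up to [o(|z - zs|)]. On a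
    rectangle of scale [s = 2^-n] both this error and the perimeter are proportional to [s], so the
    integral is [o(s^2)], whereas the choice of quarters keeps it at least [4^-n = s^2] times the
    original one. *)
Lemma goursat (F : C -> C) (a b c d : R) :
  a <= b -> c <= d ->
  (forall z, in_rect a b c d z -> C_differentiable F z) ->
  rect_int F a b c d = 0%C.
Proof.
  intros Hab Hcd HF.
  assert (CF : continuous_on_rect F a b c d)
    by (intros z Hz; apply C_differentiable_continuous, HF, Hz).
  assert (CF' : continuous_on_rect F (fst (a, c)) (fst (a, c) + (b - a))
    (snd (a, c)) (snd (a, c) + (d - c)))
    by (apply (continuous_on_rect_sub _ _ _ _ _ _ _ _ _ CF); simpl; lra).
  destruct (goursat_corners F (b - a) (d - c) ltac:(lra) ltac:(lra) (a, c) CF') as [p Hp].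
  simpl in Hp; clear CF'.
  replace (a + 1 * (b - a)) with b in Hp by ring.
  replace (c + 1 * (d - c)) with d in Hp by ring.
  destruct (nested_halving (fun n => fst (p n)) (b - a)) as [x Hx]; [lra|intros n; apply Hp|].
  destruct (nested_halving (fun n => snd (p n)) (d - c)) as [y Hy]; [lra|intros n; apply Hp|].
  simpl in Hx, Hy.
  apply Cmod_eq_0, Rle_antisym; [|apply Cmod_ge_0].
  apply Rnot_lt_le; intros Pos.
  set (e0 := Cmod (rect_int F a b c d)) in *.
  set (D := (b - a) + (d - c)).
  assert (HD : 0 <= D) by (unfold D; lra).
  set (zs := (x, y) : C).
  assert (Hzs : in_rect a b c d zs).
  { specialize (Hx O); specialize (Hy O); specialize (Hp O); simpl in *.
    rewrite Rinv_1 in Hp; split; simpl; lra. }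
  destruct (HF zs Hzs) as (phi & Hphi & E).
  (* This makes [4 * e1 * (D * D)] smaller than [e0]; the added 1 covers a rectangle reduced to a
     point. *)
  set (e1 := e0 / (8 * (D * D + 1))).
  assert (HDD : 0 <= D * D) by (apply Rmult_le_pos; lra).
  assert (He1 : 0 < e1) by (unfold e1; apply Rdiv_lt_0_compat; lra).
  destruct (proj1 (C_continuous_eps _ _) Hphi e1 He1) as (d1 & Hd1 & H1).
  apply locally_C in E; destruct E as (d2 & Hd2 & H2).
  destruct (pow2_large (D / Rmin d1 d2)) as [n Hn].
  assert (P2 : 0 < 2 ^ n) by (apply pow_lt; lra).
  assert (Ps : 0 < / 2 ^ n) by (apply Rinv_0_lt_compat, P2).
  assert (Pm : 0 < Rmin d1 d2) by (apply Rmin_glb_lt; assumption).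
  set (s := / 2 ^ n) in *.
  assert (Hsmall : s * D < Rmin d1 d2).
  { apply Rmult_lt_reg_l with (2 ^ n); [exact P2|].
    unfold s; rewrite <- Rmult_assoc, Rinv_r, Rmult_1_l by lra.
    apply Rmult_lt_compat_r with (r := Rmin d1 d2) in Hn; [|exact Pm].
    unfold Rdiv in Hn; rewrite Rmult_assoc, Rinv_l, Rmult_1_r in Hn by lra; exact Hn. }
  destruct (Hp n) as (B1 & B2 & B3 & B4 & _ & _ & B5).
  specialize (Hx n); specialize (Hy n).
  replace ((b - a) / 2 ^ n) with (s * (b - a)) in Hx by (unfold s; field; lra).
  replace ((d - c) / 2 ^ n) with (s * (d - c)) in Hy by (unfold s; field; lra).
  set (a' := fst (p n)) in *; set (c' := snd (p n)) in *.
  set (b' := a' + s * (b - a)) in *; set (d' := c' + s * (d - c)) in *.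
  change (b' <= a + (b - a)) in B2; change (d' <= c + (d - c)) in B4.
  change (e0 <= 4 ^ n * Cmod (rect_int F a' b' c' d')) in B5.
  assert (Hab' : a' <= b') by lra.
  assert (Hcd' : c' <= d') by lra.
  assert (Near : forall z, in_rect a' b' c' d' z -> Cmod (z - zs) <= s * D).
  { intros z [Z1 Z2]; eapply Rle_trans; [apply Cmod_le_sum_components|].
    unfold zs, D; simpl.
    assert (Rabs (fst z + - x) <= s * (b - a)) by (apply Rabs_le; unfold b' in *; lra).
    assert (Rabs (snd z + - y) <= s * (d - c)) by (apply Rabs_le; unfold d' in *; lra).
    lra. }
  (* [k + phi zs * z] is the tangent to [F] at [zs]; its integral vanishes. *)
  pose (k := (F zs - phi zs * zs)%C).
  assert (CF' : continuous_on_rect F a' b' c' d')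
    by (apply (continuous_on_rect_sub _ _ _ _ _ _ _ _ _ CF); lra).
  assert (CA : continuous_on_rect (fun z => k + phi zs * z)%C a' b' c' d').
  { intros z _; apply C_continuous_plus; [apply C_continuous_const|].
    apply C_continuous_mult; [apply C_continuous_const|apply continuous_id]. }
  assert (CFA : continuous_on_rect (fun z => F z - (k + phi zs * z))%C a' b' c' d').
  { intros z Hz; apply (continuous_ext (fun z => F z + (- (1)) * (k + phi zs * z))%C).
    - intros t; C_ring.
    - apply C_continuous_plus; [apply CF', Hz|].
      apply C_continuous_mult; [apply C_continuous_const|apply CA, Hz]. }
  assert (EI : rect_int F a' b' c' d'
    = rect_int (fun z => F z - (k + phi zs * z))%C a' b' c' d').
  { rewrite rect_int_minus by (assumption || apply continuous_on_rect_boundary; assumption).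
    rewrite rect_int_affine; ring. }
  assert (Bound : Cmod (rect_int F a' b' c' d') <= 4 * (e1 * (s * D)) * ((b' - a') + (d' - c'))).
  { rewrite EI; apply rect_int_bound; try assumption;
      [apply continuous_on_rect_boundary; assumption|].
    intros z [Hz _]; pose proof (Near z Hz) as Nz.
    assert (N1 : Cmod (z - zs) < d1) by (pose proof (Rmin_l d1 d2); lra).
    assert (N2 : Cmod (z - zs) < d2) by (pose proof (Rmin_r d1 d2); lra).
    specialize (H1 z N1); specialize (H2 z N2).
    replace (F z - (k + phi zs * z))%C with ((phi z - phi zs) * (z - zs))%C
      by (rewrite H2; unfold k; ring).
    rewrite Cmod_mult; apply Rmult_le_compat; try apply Cmod_ge_0; lra. }
  replace ((b' - a') + (d' - c')) with (s * D) in Bound by (unfold b', d', D; ring).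
  replace (4 * (e1 * (s * D)) * (s * D)) with (4 * e1 * (D * D) * (s * s)) in Bound by ring.
  assert (P4 : 4 ^ n * (s * s) = 1).
  { unfold s; replace 4 with (2 * 2) by ring; rewrite Rpow_mult_distr; field; lra. }
  assert (Q4 : 0 < 4 ^ n) by (apply pow_lt; lra).
  assert (Final : e0 <= 4 * e1 * (D * D)).
  { eapply Rle_trans; [exact B5|].
    apply Rmult_le_compat_l with (r := 4 ^ n) in Bound; [|lra].
    eapply Rle_trans; [exact Bound|].
    replace (4 ^ n * (4 * e1 * (D * D) * (s * s))) with (4 ^ n * (s * s) * (4 * e1 * (D * D))) by ring.
    rewrite P4; lra. }
  assert (Ee : e1 * (8 * (D * D + 1)) = e0) by (unfold e1; field; lra).
  nra.
Qed.

(* Cutting out a small square around [p] leaves four rectangles on which [F] is differentiable. *)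
Lemma goursat_except_point (F : C -> C) (a b c d : R) (p : C) :
  a < fst p < b -> c < snd p < d ->
  (forall z, in_rect a b c d z -> z <> p -> C_differentiable F z) ->
  C_continuous F p ->
  rect_int F a b c d = 0%C.
Proof.
  intros Hx Hy HF Hp.
  assert (CF : continuous_on_rect F a b c d).
  { intros z Hz; destruct (Ceq_dec z p) as [->|N]; [exact Hp|].
    apply C_differentiable_continuous, HF; assumption. }
  destruct (proj1 (C_continuous_eps _ _) Hp 1 Rlt_0_1) as (d1 & Hd1 & H1).
  set (r := Rmin (Rmin (fst p - a) (b - fst p)) (Rmin (snd p - c) (d - snd p))).
  assert (Hr : 0 < r /\ r <= fst p - a /\ r <= b - fst p /\ r <= snd p - c /\ r <= d - snd p).
  { unfold r; repeat split.
    - repeat apply Rmin_glb_lt; lra.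
    - eapply Rle_trans; [apply Rmin_l|apply Rmin_l].
    - eapply Rle_trans; [apply Rmin_l|apply Rmin_r].
    - eapply Rle_trans; [apply Rmin_r|apply Rmin_l].
    - eapply Rle_trans; [apply Rmin_r|apply Rmin_r]. }
  set (M := Cmod (F p) + 1).
  assert (HM : 0 < M) by (unfold M; pose proof (Cmod_ge_0 (F p)); lra).
  apply Cmod_eq_0, Rle_antisym; [|apply Cmod_ge_0].
  apply Rnot_lt_le; intros Pos.
  set (e0 := Cmod (rect_int F a b c d)) in *.
  (* [t] is half the side of the square: [r] keeps it inside the rectangle, [d1 / 4] gives
     [|F| <= M] on it, and the last term makes its integral at most [16 * M * t <= e0 / 4]. *)
  set (t := Rmin (Rmin r (d1 / 4)) (e0 / (64 * M))).
  assert (Ht : 0 < t /\ t <= r /\ t <= d1 / 4 /\ t <= e0 / (64 * M)).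
  { assert (0 < e0 / (64 * M)) by (apply Rdiv_lt_0_compat; lra).
    unfold t; repeat split.
    - repeat apply Rmin_glb_lt; lra.
    - eapply Rle_trans; [apply Rmin_l|apply Rmin_l].
    - eapply Rle_trans; [apply Rmin_l|apply Rmin_r].
    - apply Rmin_r. }
  destruct Ht as (Ht0 & Ht1 & Ht2 & Ht3), Hr as (Hr0 & Hr1 & Hr2 & Hr3 & Hr4).
  assert (Z : forall a' b' c' d', a <= a' -> a' <= b' -> b' <= b -> c <= c' -> c' <= d' -> d' <= d ->
    (b' < fst p \/ fst p < a' \/ d' < snd p \/ snd p < c') ->
    rect_int F a' b' c' d' = 0%C).
  { intros a' b' c' d' A1 A2 A3 A4 A5 A6 Out; apply goursat; try assumption.
    intros z [Z1 Z2]; apply HF; [split; lra|]; intros ->; lra. }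
  assert (E : rect_int F a b c d
    = rect_int F (fst p - t) (fst p + t) (snd p - t) (snd p + t)).
  { rewrite (rect_int_split_x F a (fst p - t)) by (try lra; exact CF).
    rewrite (rect_int_split_x F (fst p - t) (fst p + t));
      [|lra|lra|apply (continuous_on_rect_sub _ _ _ _ _ _ _ _ _ CF); lra].
    rewrite (rect_int_split_y F (fst p - t) (fst p + t) c (snd p - t));
      [|lra|lra|apply (continuous_on_rect_sub _ _ _ _ _ _ _ _ _ CF); lra].
    rewrite (rect_int_split_y F (fst p - t) (fst p + t) (snd p - t) (snd p + t));
      [|lra|lra|apply (continuous_on_rect_sub _ _ _ _ _ _ _ _ _ CF); lra].
    rewrite (Z a (fst p - t) c d), (Z (fst p + t) b c d),
      (Z (fst p - t) (fst p + t) c (snd p - t)),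
      (Z (fst p - t) (fst p + t) (snd p + t) d) by lra.
    ring. }
  assert (Bound : e0 <= 4 * M * ((fst p + t - (fst p - t)) + (snd p + t - (snd p - t)))).
  { unfold e0; rewrite E; apply rect_int_bound; [lra|lra| |].
    - apply continuous_on_rect_boundary, (continuous_on_rect_sub _ _ _ _ _ _ _ _ _ CF); lra.
    - intros z [[Z1 Z2] _].
      assert (Nz : Cmod (z - p) < d1).
      { eapply Rle_lt_trans; [apply Cmod_le_sum_components|]; simpl.
        assert (Rabs (fst z + - fst p) <= t) by (apply Rabs_le; lra).
        assert (Rabs (snd z + - snd p) <= t) by (apply Rabs_le; lra).
        lra. }
      specialize (H1 z Nz).
      replace (F z) with ((F z - F p) + F p)%C by ring.
      eapply Rle_trans; [apply Cmod_triangle|]; unfold M; lra. }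
  assert (t * (64 * M) <= e0).
  { apply Rmult_le_compat_r with (r := 64 * M) in Ht3; [|lra].
    unfold Rdiv in Ht3; rewrite Rmult_assoc, Rinv_l, Rmult_1_r in Ht3 by lra; exact Ht3. }
  lra.
Qed.

(** * Cauchy's estimate *)

Lemma C_neq_sub (z p : C) : z <> p -> (z - p)%C <> 0%C.
Proof. intros N E; apply N, Ceq_minus; exact E. Qed.

Lemma C_continuous_inv_sub (p z : C) : z <> p -> C_continuous (fun w => / (w - p))%C z.
Proof.
  intros N; apply (continuous_comp (fun w => w - p)%C Cinv).
  - apply C_continuous_plus; [apply continuous_id|apply C_continuous_const].
  - apply C_continuous_inv, C_neq_sub, N.
Qed.

Lemma C_differentiable_inv_sub (p z : C) : z <> p -> C_differentiable (fun w => / (w - p))%C z.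
Proof.
  intros N; apply (C_differentiable_comp Cinv (fun w => w - p)%C).
  - apply C_differentiable_minus; [apply C_differentiable_id|apply C_differentiable_const].
  - apply C_differentiable_inv, C_neq_sub, N.
Qed.

(* Each of the four sides contributes a positive amount to the imaginary part. *)
Lemma rect_int_inv_sub_neq_0 (a b c d : R) (p : C) :
  a < fst p < b -> c < snd p < d ->
  rect_int (fun z => / (z - p))%C a b c d <> 0%C.
Proof.
  intros Hx Hy.
  assert (CB : continuous_on_boundary (fun z => / (z - p))%C a b c d).
  { intros z [_ Hz]; apply C_continuous_inv_sub; intros ->; lra. }
  destruct (rect_sides_integrable _ a b c d ltac:(lra) ltac:(lra) CB)
    as [[[_ I1] [_ I2]] [[I3 _] [I4 _]]].
  intros E; apply (f_equal snd) in E; revert E.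
  unfold rect_int, C_int; simpl.
  simpl in I1, I2, I3, I4.
  (* The integrands are captured from the integrability facts in the form that [simpl] gave them. *)
  set (f1 := fun t : R => _ : R) in I1.
  set (f2 := fun t : R => _ : R) in I2.
  set (f3 := fun t : R => _ : R) in I3.
  set (f4 := fun t : R => _ : R) in I4.
  fold f1 f2 f3 f4.
  assert (Sq : forall u v, u <> 0 \/ v <> 0 -> 0 < u * (u * 1) + v * (v * 1)).
  { intros u v [N|N]; pose proof (pow2_gt_0 _ N); nra. }
  assert (Pos : forall k u v, 0 <= k -> u <> 0 \/ v <> 0 ->
    0 <= k / (u * (u * 1) + v * (v * 1)))
    by (intros; apply Rmult_le_pos; [assumption|left; apply Rinv_0_lt_compat, Sq; assumption]).
  assert (Neg : forall k u v, 0 <= - k -> u <> 0 \/ v <> 0 ->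
    k / (u * (u * 1) + v * (v * 1)) <= 0).
  { intros k u v Hk Huv; pose proof (Pos (- k) u v Hk Huv) as H.
    unfold Rdiv in *; rewrite <- Ropp_mult_distr_l in H; lra. }
  assert (Z : forall (f : R -> R) u v, u <= v -> ex_RInt f u v ->
    (forall t, u < t < v -> f t <= 0) -> RInt f u v <= 0).
  { intros f u v Huv If Hf.
    replace 0 with (RInt (fun _ => 0) u v)
      by (rewrite (RInt_const (V := R_CompleteNormedModule)); unfold scal; simpl; unfold mult; simpl; ring).
    apply RInt_le; auto; apply ex_RInt_const. }
  (* Strict positivity on the bottom side suffices; the other three sides only need the right
     sign. *)
  assert (P1 : 0 < RInt f1 a b).
  { apply RInt_gt_0; [lra| |]; intros t _; unfold f1.
    - apply Rdiv_lt_0_compat; [lra|apply Sq; right; lra].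
    - apply (ex_derive_continuous (V := R_NormedModule)); auto_derive.
      apply Rgt_not_eq, Sq; right; lra. }
  assert (P2 : RInt f2 a b <= 0).
  { apply Z; [lra|exact I2|]; intros t _; apply Neg; [lra|right; lra]. }
  assert (P3 : RInt f3 c d <= 0).
  { apply Z; [lra|exact I3|]; intros t _; apply Neg; [lra|left; lra]. }
  assert (P4 : 0 <= RInt f4 c d).
  { apply RInt_ge_0; [lra|exact I4|]; intros t _; apply Pos; [lra|left; lra]. }
  intros E; lra.
Qed.

(** Cauchy's formula with [2 pi i] replaced by the nonzero number [J]. The constant [K] is fixed
    before [H], so that it serves all remainders at once. *)
Lemma rect_cauchy_estimate (a b c d : R) (p : C) :
  a < fst p < b -> c < snd p < d ->
  exists K, 0 <= K /\ forall (H : C -> C) (sigma : R),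
    (forall z, in_rect a b c d z -> C_differentiable H z) ->
    (forall z, on_rect_boundary a b c d z -> Cmod (H z) <= sigma) ->
    Cmod (H p) <= K * sigma.
Proof.
  intros Hx Hy.
  set (J := rect_int (fun z => / (z - p))%C a b c d).
  assert (HJ : 0 < Cmod J) by (apply Cmod_gt_0, rect_int_inv_sub_neq_0; assumption).
  set (r := Rmin (Rmin (fst p - a) (b - fst p)) (Rmin (snd p - c) (d - snd p))).
  assert (Hr : 0 < r) by (unfold r; repeat apply Rmin_glb_lt; lra).
  assert (Far : forall z, on_rect_boundary a b c d z -> r <= Cmod (z - p)).
  { intros z [[Z1 Z2] Hz].
    pose proof (Rabs_fst_le_Cmod (z - p)) as F1; pose proof (Rabs_snd_le_Cmod (z - p)) as F2.
    simpl in F1, F2.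
    pose proof (Rmin_l (Rmin (fst p - a) (b - fst p)) (Rmin (snd p - c) (d - snd p))).
    pose proof (Rmin_r (Rmin (fst p - a) (b - fst p)) (Rmin (snd p - c) (d - snd p))).
    pose proof (Rmin_l (fst p - a) (b - fst p)); pose proof (Rmin_r (fst p - a) (b - fst p)).
    pose proof (Rmin_l (snd p - c) (d - snd p)); pose proof (Rmin_r (snd p - c) (d - snd p)).
    pose proof (Rle_abs (fst z + - fst p)); pose proof (Rle_abs (snd z + - snd p)).
    pose proof (Rle_abs (- (fst z + - fst p))); pose proof (Rle_abs (- (snd z + - snd p))).
    rewrite Rabs_Ropp in *; unfold r; destruct Hz as [E|[E|[E|E]]]; lra. }
  assert (Off : forall z, on_rect_boundary a b c d z -> z <> p).
  { intros z [_ Hz] ->; lra. }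
  (* On the boundary [|H z / (z - p)| <= sigma / r]; the rest is the constant of [rect_int_bound],
     divided by [|J|]. *)
  exists (4 * ((b - a) + (d - c)) / (r * Cmod J)); split.
  { apply Rmult_le_pos; [lra|]; left; apply Rinv_0_lt_compat, Rmult_lt_0_compat; assumption. }
  intros H sigma DH Hsigma.
  assert (Inp : in_rect a b c d p) by (split; lra).
  destruct (DH p Inp) as (phi & Hphi & E).
  (* The difference quotient of [H] with its removable singularity filled in; near [p] it coincides
     with [phi], hence is continuous there. *)
  set (F := fun z => if Ceq_dec z p then phi p else ((H z - H p) * / (z - p))%C).
  assert (IF : rect_int F a b c d = 0%C).
  { apply goursat_except_point with p; try assumption.
    - intros z Hz N.
      apply (C_differentiable_ext_loc (fun w => (H w - H p) * / (w - p))%C).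
      + apply locally_C; exists (Cmod (z - p)); split; [apply Cmod_gt_0, C_neq_sub, N|].
        intros w Hw; unfold F; destruct (Ceq_dec w p) as [->|_]; [|reflexivity].
        rewrite Cmod_sub_sym in Hw; lra.
      + apply C_differentiable_mult; [|apply C_differentiable_inv_sub, N].
        apply C_differentiable_minus; [apply DH, Hz|apply C_differentiable_const].
    - apply (continuous_ext_loc _ phi); [|exact Hphi].
      revert E; apply (filter_imp (F := locally (T := C_UniformSpace) p)).
      intros w Ew; unfold F; destruct (Ceq_dec w p) as [->|N]; [reflexivity|].
      rewrite Ew; C_field; apply C_neq_sub, N. }
  assert (CH : continuous_on_boundary H a b c d).
  { intros z [Hz _]; apply C_differentiable_continuous, DH, Hz. }
  assert (Cinvp : continuous_on_boundary (fun z => / (z - p))%C a b c d)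
    by (intros z Hz; apply C_continuous_inv_sub, Off, Hz).
  assert (CG : continuous_on_boundary (fun z => H z * / (z - p))%C a b c d)
    by (intros z Hz; apply C_continuous_mult; [apply CH, Hz|apply Cinvp, Hz]).
  assert (EI : rect_int (fun z => H z * / (z - p))%C a b c d = (H p * J)%C).
  { unfold J; rewrite <- rect_int_scal by (assumption || lra).
    apply Ceq_minus; rewrite <- rect_int_minus; try lra; try assumption.
    - rewrite <- IF; apply rect_int_ext; try lra.
      intros z Hz; unfold F; destruct (Ceq_dec z p) as [Ep|_]; [elim (Off z Hz Ep)|ring].
    - intros z Hz; apply C_continuous_mult; [apply C_continuous_const|apply Cinvp, Hz]. }
  assert (B : Cmod (H p * J) <= 4 * (sigma / r) * ((b - a) + (d - c))).
  { rewrite <- EI; apply rect_int_bound; [lra|lra|exact CG|].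
    intros z Hz; rewrite Cmod_mult, Cmod_inv by (apply C_neq_sub, Off, Hz).
    apply Rmult_le_compat; [apply Cmod_ge_0| |apply Hsigma, Hz|].
    - left; apply Rinv_0_lt_compat; pose proof (Far z Hz); lra.
    - apply Rinv_le_contravar; [exact Hr|apply Far, Hz]. }
  rewrite Cmod_mult in B.
  apply Rmult_le_reg_r with (Cmod J); [exact HJ|].
  eapply Rle_trans; [exact B|].
  right; field; lra.
Qed.

(** * Estimates on the boundary of the rectangle *)

(* The weight [((z - x)^2 + h^2)^2], with [x^2 + h^2 = 1], has double zeros at the two points where the boundary of the rectangle crosses the unit circle. *)
Lemma damped_rectangle (rho : R) : 0 < rho ->
  exists (a b h D : R) (P : C -> C),
    (a < 1 < b /\ 0 < h /\ 0 <= D) /\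
    (forall z, in_rect a b (- h) h z -> Cmod (z - 1) < rho /\ / 2 <= Cmod z <= 2) /\
    (forall z, on_rect_boundary a b (- h) h z -> Cmod (P z) <= D * (Cmod z - 1) ^ 2) /\
    0 < Cmod (P 1%C) /\
    (forall z, C_differentiable P z).
Proof.
  intros Hrho.
  (* Points of the rectangle are within [3 * h] of 1, and [h <= 1 / 4] keeps their real parts at
     least [1 / 2]. *)
  set (h := Rmin rho 1 / 4).
  assert (Hh : 0 < h /\ h <= / 4 /\ 4 * h <= rho).
  { unfold h; pose proof (Rmin_l rho 1); pose proof (Rmin_r rho 1).
    assert (0 < Rmin rho 1) by (apply Rmin_glb_lt; lra); lra. }
  destruct Hh as (Hh0 & Hh1 & Hh2).
  (* The horizontal sides, centred at abscissa [x1], meet the unit circle at their midpoints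
     [(x1, h)] and [(x1, - h)]. *)
  set (x1 := sqrt (1 - h * h)).
  assert (X0 : 0 <= x1) by apply sqrt_pos.
  assert (X1 : x1 * x1 = 1 - h * h) by (apply sqrt_sqrt; nra).
  assert (X2 : 3 / 4 <= x1) by nra.
  assert (X3 : x1 < 1) by nra.
  assert (X4 : 1 - h < x1) by nra.
  set (P := fun z : C => ((((z - x1) * (z - x1) + (h * h)%R)) ^ 2)%C).
  assert (EP : forall z, Cmod (P z) =
    ((fst z - x1) ^ 2 - snd z ^ 2 + h ^ 2) ^ 2 + 4 * (fst z - x1) ^ 2 * snd z ^ 2).
  { intros [x y]; unfold P; rewrite Cmod_pow, Cmod2_alt; simpl; ring. }
  (* With [r = |z|], the 9 bounds [(r + 1)^2] and so replaces [r^2 - 1] by [r - 1]. The [1 / h^2] is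
     for the vertical sides, where [|r^2 - 1| >= h] and [|P| <= 1]. *)
  exists (x1 - h), (x1 + h), h, (9 / (h * h)), P.
  assert (Hhh : 0 < h * h) by nra.
  assert (HD : (9 / (h * h)) * (h * h) = 9) by (field; lra).
  assert (HD0 : 9 <= 9 / (h * h)).
  { apply Rmult_le_reg_r with (h * h); [exact Hhh|]; rewrite HD; nra. }
  assert (Hin : forall z, in_rect (x1 - h) (x1 + h) (- h) h z ->
    Cmod (z - 1) < rho /\ / 2 <= Cmod z <= 2).
  { intros z [Z1 Z2]; split; [|split].
    - eapply Rle_lt_trans; [apply Cmod_le_sum_components|]; simpl.
      assert (Rabs (fst z + - (1)) < 2 * h) by (apply Rabs_def1; lra).
      assert (Rabs (snd z + - 0) <= h) by (apply Rabs_le; lra).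
      lra.
    - eapply Rle_trans; [|apply Rabs_fst_le_Cmod]; rewrite Rabs_pos_eq; lra.
    - eapply Rle_trans; [apply Cmod_le_sum_components|].
      assert (Rabs (snd z) <= h) by (apply Rabs_le; lra).
      rewrite (Rabs_pos_eq (fst z)) by lra; lra. }
  split; [repeat split; lra|]; split; [exact Hin|]; split; [|split].
  - intros z [Hz Hb]; rewrite EP.
    destruct (Hin z Hz) as (_ & R1 & R2), Hz as [Z1 Z2].
    pose proof (Cmod2_alt z) as Ez; unfold Re, Im in Ez.
    set (r := Cmod z) in *; set (x := fst z) in *; set (y := snd z) in *.
    assert (Sq : (r ^ 2 - 1) ^ 2 <= 9 * (r - 1) ^ 2).
    { replace ((r ^ 2 - 1) ^ 2) with ((r + 1) ^ 2 * (r - 1) ^ 2) by ring.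
      apply Rmult_le_compat_r; [apply pow2_ge_0|nra]. }
    assert (S0 : 0 <= (r - 1) ^ 2) by apply pow2_ge_0.
    (* Here [r^2 - 1 = x^2 - x1^2], so the distance [|x - x1|] to the crossing is at most
       [|r^2 - 1|]. *)
    assert (Horizontal : y ^ 2 = h ^ 2 -> ((x - x1) ^ 2 - y ^ 2 + h ^ 2) ^ 2 + 4 * (x - x1) ^ 2 * y ^ 2
      <= 9 / (h * h) * (r - 1) ^ 2).
    { intros Ey; rewrite Ey in *.
      assert (Er : r ^ 2 - 1 = (x - x1) * (x + x1)) by (rewrite Ez; nra).
      assert (Hu : 0 <= (x - x1) ^ 2 <= h ^ 2) by (split; [apply pow2_ge_0|nra]).
      assert (U : (x - x1) ^ 2 <= (r ^ 2 - 1) ^ 2).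
      { rewrite Er, Rpow_mult_distr; assert (1 <= (x + x1) ^ 2) by nra; nra. }
      assert (0 <= (r - 1) ^ 2 * (9 / (h * h) - 9)) by (apply Rmult_le_pos; lra).
      assert (((x - x1) ^ 2 - h ^ 2 + h ^ 2) ^ 2 + 4 * (x - x1) ^ 2 * h ^ 2 <= (x - x1) ^ 2).
      { replace (((x - x1) ^ 2 - h ^ 2 + h ^ 2) ^ 2 + 4 * (x - x1) ^ 2 * h ^ 2)
          with ((x - x1) ^ 2 * ((x - x1) ^ 2 + 4 * h ^ 2)) by ring.
        rewrite <- (Rmult_1_r ((x - x1) ^ 2)) at 3.
        apply Rmult_le_compat_l; [lra|nra]. }
      lra. }
    assert (Vertical : (x - x1) ^ 2 = h ^ 2 -> h ^ 2 <= (r ^ 2 - 1) ^ 2 ->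
      ((x - x1) ^ 2 - y ^ 2 + h ^ 2) ^ 2 + 4 * (x - x1) ^ 2 * y ^ 2
      <= 9 / (h * h) * (r - 1) ^ 2).
    { intros Ex Hr; rewrite Ex.
      assert (Hy : 0 <= y ^ 2 <= h ^ 2) by (split; [apply pow2_ge_0|nra]).
      assert (1 <= 9 / (h * h) * (r - 1) ^ 2).
      { apply Rmult_le_reg_l with (h * h); [exact Hhh|].
        replace (h * h * (9 / (h * h) * (r - 1) ^ 2)) with (9 * (r - 1) ^ 2) by (field; lra).
        lra. }
      assert (Hk : 0 <= h ^ 2 <= / 16)
        by (split; [apply pow2_ge_0|]; replace (/ 16) with ((/ 4) ^ 2) by field; apply pow_incr; lra).
      replace ((h ^ 2 - y ^ 2 + h ^ 2) ^ 2 + 4 * h ^ 2 * y ^ 2)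
        with (4 * (h ^ 2) ^ 2 + (y ^ 2) ^ 2) by ring.
      pose proof (pow_incr (y ^ 2) (/ 16) 2 ltac:(lra)).
      pose proof (pow_incr (h ^ 2) (/ 16) 2 ltac:(lra)).
      lra. }
    assert (Hy : y ^ 2 <= h * h).
    { assert (0 <= (h - y) * (h + y)) by (apply Rmult_le_pos; lra); lra. }
    assert (Hx1 : 3 / 4 * h <= x1 * h) by (apply Rmult_le_compat_r; lra).
    assert (Hh4 : h * h <= / 4 * h) by (apply Rmult_le_compat_r; lra).
    assert (Hy0 : 0 <= y ^ 2) by apply pow2_ge_0.
    destruct Hb as [E|[E|[E|E]]].
    + apply Vertical; [rewrite E; ring|].
      assert (r ^ 2 - 1 <= - h).
      { rewrite Ez, E; replace ((x1 - h) ^ 2) with (x1 * x1 - 2 * (x1 * h) + h * h) by ring; lra. }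
      replace ((r ^ 2 - 1) ^ 2) with ((1 - r ^ 2) ^ 2) by ring; apply pow_incr; lra.
    + apply Vertical; [rewrite E; ring|].
      assert (h <= r ^ 2 - 1).
      { rewrite Ez, E; replace ((x1 + h) ^ 2) with (x1 * x1 + 2 * (x1 * h) + h * h) by ring; lra. }
      apply pow_incr; lra.
    + apply Horizontal; rewrite E; ring.
    + apply Horizontal; rewrite E; ring.
  - rewrite EP; simpl.
    assert (0 < (1 - x1) ^ 2 - 0 ^ 2 + h ^ 2) by nra.
    simpl in *; nra.
  - intros z; apply C_differentiable_pow.
    apply C_differentiable_plus; [|apply C_differentiable_const].
    apply C_differentiable_mult;
      (apply C_differentiable_minus; [apply C_differentiable_id|apply C_differentiable_const]).
Qed.

(** * Geometric bounds for power series with bounded coefficients *)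

Lemma partial_sum_S (a : nat -> C) (n : nat) (z : C) :
  partial_sum a (S n) z = (partial_sum a n z + a (S n) * z ^ S n)%C.
Proof. unfold partial_sum; rewrite sum_Sn; reflexivity. Qed.

(** A finite geometric sum cleared of its denominator; the factor [1 - |z|^k] makes the induction on
    [k] close. *)
Lemma partial_sum_block (a : nat -> C) (e : R) (n k : nat) (z : C) :
  Cmod z <= 1 -> (forall j, (j < k)%nat -> Cmod (a (S n + j)%nat) <= e) ->
  Cmod (partial_sum a (n + k) z - partial_sum a n z) * (1 - Cmod z)
  <= e * Cmod z ^ S n * (1 - Cmod z ^ k).
Proof.
  intros Hz; induction k as [|k IH]; intros Ha.
  - rewrite Nat.add_0_r; replace (partial_sum a n z - partial_sum a n z)%C with (RtoC 0) by ring.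
    rewrite Cmod_0; simpl; lra.
  - rewrite Nat.add_succ_r, partial_sum_S.
    replace (partial_sum a (n + k) z + a (S (n + k)) * z ^ S (n + k) - partial_sum a n z)%C
      with ((partial_sum a (n + k) z - partial_sum a n z) + a (S (n + k)) * z ^ S (n + k))%C by ring.
    specialize (IH ltac:(intros j Hj; apply Ha; lia)).
    specialize (Ha k (Nat.lt_succ_diag_r k)).
    replace (S n + k)%nat with (S (n + k)) in Ha by lia.
    pose proof (Cmod_triangle (partial_sum a (n + k) z - partial_sum a n z) (a (S (n + k)) * z ^ S (n + k))) as T.
    rewrite Cmod_mult, Cmod_pow in T.
    pose proof (Cmod_ge_0 z) as R0; set (r := Cmod z) in *.
    assert (Rn : 0 <= r ^ S (n + k)) by (apply pow_le, R0).
    assert (T' : Cmod (a (S (n + k))) * r ^ S (n + k) <= e * r ^ S (n + k))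
      by (apply Rmult_le_compat_r; assumption).
    replace (e * r ^ S n * (1 - r ^ S k))
      with (e * r ^ S n * (1 - r ^ k) + e * r ^ S (n + k) * (1 - r))
      by (replace (S (n + k)) with (S n + k)%nat by lia; rewrite pow_add; simpl; ring).
    eapply Rle_trans; [apply Rmult_le_compat_r; [lra|]; exact T|].
    assert (Cmod (a (S (n + k))) * r ^ S (n + k) * (1 - r) <= e * r ^ S (n + k) * (1 - r))
      by (apply Rmult_le_compat_r; lra).
    lra.
Qed.

(** The limit of [partial_sum_block] as the length of the block grows: a violation by [gap] is
    refuted by a partial sum within [gap] of [g z]. *)
Lemma power_series_tail (a : nat -> C) (g : C -> C) (A : R) (n : nat) (z : C) :
  is_power_series_sum a g -> Cmod z < 1 -> (forall k, Cmod (a k) <= A) ->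
  Cmod (g z - partial_sum a n z) * (1 - Cmod z) <= A * Cmod z ^ S n.
Proof.
  intros Hg Hz HA.
  pose proof (Cmod_ge_0 z) as R0.
  assert (HA0 : 0 <= A) by (eapply Rle_trans; [apply Cmod_ge_0|apply (HA O)]).
  apply Rnot_lt_le; intros Hlt.
  set (T := A * Cmod z ^ S n) in *.
  set (gap := Cmod (g z - partial_sum a n z) * (1 - Cmod z) - T).
  assert (Hgap : 0 < gap) by (unfold gap; lra).
  pose proof (Hg z Hz) as S.
  assert (N : locally (T := C_UniformSpace) (g z) (fun w => Cmod (w - g z) < gap))
    by (apply locally_C; exists gap; auto).
  destruct (S _ N) as [m Hm]; clear S N.
  specialize (Hm (n + m)%nat ltac:(lia)).
  change (Cmod (partial_sum a (n + m) z - g z) < gap) in Hm.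
  pose proof (partial_sum_block a A n m z ltac:(lra) (fun j _ => HA _)) as B.
  fold T in B.
  assert (HT : T * (1 - Cmod z ^ m) <= T).
  { assert (0 <= T * Cmod z ^ m) by (apply Rmult_le_pos; [apply Rmult_le_pos; [lra|]|]; apply pow_le; lra).
    lra. }
  pose proof (Cmod_triangle (partial_sum a (n + m) z - partial_sum a n z) (g z - partial_sum a (n + m) z)) as Tr.
  replace (partial_sum a (n + m) z - partial_sum a n z + (g z - partial_sum a (n + m) z))%C
    with (g z - partial_sum a n z)%C in Tr by ring.
  rewrite (Cmod_sub_sym (g z) (partial_sum a (n + m) z)) in Tr.
  assert (Cmod (partial_sum a (n + m) z - g z) * (1 - Cmod z) <= Cmod (partial_sum a (n + m) z - g z))
    by (pose proof (Cmod_ge_0 (partial_sum a (n + m) z - g z)); nra).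
  apply Rmult_le_compat_r with (r := 1 - Cmod z) in Tr; [|lra].
  unfold gap in *; lra.
Qed.

(** The remainder is split at [n + J]: the block before has coefficients at most [e], the tail after
    gains [|z|^J]. *)
Lemma power_series_tail_gap (a : nat -> C) (g : C -> C) (A e : R) (n J : nat) (z : C) :
  is_power_series_sum a g -> Cmod z < 1 -> (forall k, Cmod (a k) <= A) ->
  (forall j, (j < J)%nat -> Cmod (a (S n + j)%nat) <= e) -> 0 <= e ->
  Cmod (g z - partial_sum a n z) * (1 - Cmod z) <= (e + A * Cmod z ^ J) * Cmod z ^ S n.
Proof.
  intros Hg Hz HA He He0.
  pose proof (power_series_tail a g A (n + J) z Hg Hz HA) as T.
  pose proof (partial_sum_block a e n J z ltac:(lra) He) as B.
  pose proof (Cmod_triangle (g z - partial_sum a (n + J) z) (partial_sum a (n + J) z - partial_sum a n z)) as Tr.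
  replace (g z - partial_sum a (n + J) z + (partial_sum a (n + J) z - partial_sum a n z))%C
    with (g z - partial_sum a n z)%C in Tr by ring.
  apply Rmult_le_compat_r with (r := 1 - Cmod z) in Tr; [|lra].
  replace (S (n + J)) with (S n + J)%nat in T by lia; rewrite pow_add in T.
  assert (0 <= e * Cmod z ^ S n * Cmod z ^ J)
    by (repeat apply Rmult_le_pos; try apply pow_le; try apply Cmod_ge_0; lra).
  lra.
Qed.

Lemma partial_sum_outside (a : nat -> C) (A : R) (n : nat) (z : C) :
  1 <= Cmod z -> (forall k, Cmod (a k) <= A) ->
  Cmod (partial_sum a n z) * (Cmod z - 1) <= A * Cmod z ^ S n.
Proof.
  intros Hz HA.
  assert (HA0 : 0 <= A) by (eapply Rle_trans; [apply Cmod_ge_0|apply (HA O)]).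
  (* The exact value of the geometric sum, with its [- 1], is what the induction preserves. *)
  enough (Cmod (partial_sum a n z) * (Cmod z - 1) <= A * (Cmod z ^ S n - 1)) by lra.
  induction n as [|n IH].
  - unfold partial_sum; rewrite sum_O; simpl; rewrite Cmult_1_r.
    specialize (HA O); rewrite Rmult_1_r; apply Rmult_le_compat_r; lra.
  - rewrite partial_sum_S.
    pose proof (Cmod_triangle (partial_sum a n z) (a (S n) * z ^ S n)) as T.
    rewrite Cmod_mult, Cmod_pow in T.
    specialize (HA (S n)).
    assert (0 <= Cmod z ^ S n) by (apply pow_le, Cmod_ge_0).
    assert (Cmod (a (S n)) * Cmod z ^ S n <= A * Cmod z ^ S n) by (apply Rmult_le_compat_r; assumption).
    apply Rle_trans with ((Cmod (partial_sum a n z) + A * Cmod z ^ S n) * (Cmod z - 1)).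
    + apply Rmult_le_compat_r; lra.
    + replace (Cmod z ^ S (S n)) with (Cmod z * Cmod z ^ S n) by reflexivity.
      lra.
Qed.

(** [1 - r ^ n] is [1 - r] times the sum of the [r ^ k] with [k < n], and each of these is at least
    [r ^ n]. *)
Lemma pow_decay (r : R) (n : nat) : 0 <= r <= 1 -> INR n * ((1 - r) * r ^ n) <= 1 - r ^ n.
Proof.
  intros Hr; induction n as [|n IH]; [simpl; lra|].
  rewrite S_INR; simpl.
  assert (0 <= r ^ n) by (apply pow_le; lra).
  pose proof (pos_INR n).
  assert (0 <= (INR n + 1) * ((1 - r) * r ^ n) * (1 - r))
    by (repeat apply Rmult_le_pos; lra).
  nra.
Qed.

Lemma pow_growth (r : R) (n : nat) : 1 <= r -> INR n * (r - 1) <= r ^ n.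
Proof.
  intros Hr; destruct (Req_dec r 1) as [->|N].
  - rewrite pow1; lra.
  - pose proof (poly n (r - 1) ltac:(lra)) as B.
    replace (1 + (r - 1)) with r in B by ring; lra.
Qed.

(* Multiplying the remainder by the weight and by [z^-(n+1+N)] makes it [O(1/N)] on the part of the rectangle's boundary outside the disc; inside, once [N] is fixed, the gap after index [n] makes it small. *)
Lemma local_overconvergence (A B rho eps : R) : 0 < rho -> 0 < eps ->
  exists (e : R) (J : nat), 0 < e /\ forall (a : nat -> C) (g : C -> C) (n : nat),
    (forall k, Cmod (a k) <= A) ->
    (forall j, (j < J)%nat -> Cmod (a (S n + j)%nat) <= e) ->
    is_power_series_sum a g ->
    (forall z, Cmod (z - 1) < rho -> C_differentiable g z /\ Cmod (g z) <= B) ->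
    Cmod (partial_sum a n 1 - g 1%C) < eps.
Proof.
  intros Hrho Heps.
  (* [A] and [B] are arbitrary reals here; a negative one contradicts the bounds on [a] or [g]. *)
  destruct (Rlt_le_dec A 0) as [HA0|HA0].
  { exists 1, O; split; [lra|]; intros a g n HA.
    pose proof (HA O); pose proof (Cmod_ge_0 (a O)); lra. }
  destruct (Rlt_le_dec B 0) as [HB0|HB0].
  { exists 1, O; split; [lra|]; intros a g n _ _ _ HB.
    destruct (HB 1%C) as [_ HB1].
    - replace (1 - 1)%C with (RtoC 0) by ring; rewrite Cmod_0; exact Hrho.
    - pose proof (Cmod_ge_0 (g 1%C)); lra. }
  destruct (damped_rectangle rho Hrho) as (a0 & b0 & h & D & P & (Hab & Hh & HD) & Hin & HP & HP1 & DP).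
  destruct (rect_cauchy_estimate a0 b0 (- h) h 1%C) as (K & HK & Cauchy);
    [simpl; lra|simpl; lra|].
  (* The target for the weighted remainder on the boundary; [K + 1] avoids dividing by 0 and makes
     the conclusion strict. *)
  set (sigma := eps * Cmod (P 1%C) / (K + 1)).
  assert (Hsigma : 0 < sigma) by (unfold sigma; apply Rdiv_lt_0_compat; [apply Rmult_lt_0_compat|]; lra).
  assert (HKsigma : K * sigma < eps * Cmod (P 1%C)).
  { assert (E : (K + 1) * sigma = eps * Cmod (P 1%C)) by (unfold sigma; field; lra). lra. }
  destruct (INR_unbounded (D * (A + B) / sigma)) as [N HN].
  assert (HN' : D * (A + B) <= INR N * sigma).
  { apply Rmult_lt_compat_r with (r := sigma) in HN; [|exact Hsigma].
    unfold Rdiv in HN; rewrite Rmult_assoc, Rinv_l in HN by lra; lra. }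
  assert (HN0 : 0 < INR N).
  { eapply Rle_lt_trans; [|exact HN]; apply Rmult_le_pos;
      [apply Rmult_le_pos; lra|left; apply Rinv_0_lt_compat; lra]. }
  (* Inside the disc [|z|^-N] is at most [2^N], as [|z| >= 1 / 2]. Then [J] and [e] each account for
     half of [sigma]. *)
  set (D2 := D * 2 ^ N).
  assert (HD2 : 0 <= D2) by (unfold D2; apply Rmult_le_pos; [lra|apply pow_le; lra]).
  destruct (INR_unbounded (2 * D2 * A / sigma)) as [J HJ].
  assert (HJ' : 2 * D2 * A <= INR J * sigma).
  { apply Rmult_lt_compat_r with (r := sigma) in HJ; [|exact Hsigma].
    unfold Rdiv in HJ; rewrite Rmult_assoc, Rinv_l in HJ by lra; lra. }
  assert (HJ0 : 0 < INR J).
  { eapply Rle_lt_trans; [|exact HJ]; apply Rmult_le_pos;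
      [apply Rmult_le_pos; lra|left; apply Rinv_0_lt_compat; lra]. }
  set (e := sigma / (2 * (D2 + 1))).
  assert (He : 0 < e) by (unfold e; apply Rdiv_lt_0_compat; lra).
  assert (HDe : 2 * (D2 * e) <= sigma).
  { assert (E : 2 * (D2 + 1) * e = sigma) by (unfold e; field; lra). lra. }
  exists e, J; split; [exact He|].
  intros a g n HA HaJ Hg HB.
  set (H := fun z => ((g z - partial_sum a n z) * P z * (/ z) ^ (S n + N))%C).
  assert (BH : Cmod (H 1%C) <= K * sigma).
  { apply Cauchy.
    - intros z Hz; destruct (Hin z Hz) as (Z1 & Z2 & Z3).
      apply C_differentiable_mult; [apply C_differentiable_mult; [|apply DP]|].
      + apply C_differentiable_minus; [apply HB, Z1|apply C_differentiable_partial_sum].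
      + apply C_differentiable_pow, C_differentiable_inv, Cmod_gt_0; lra.
    - intros z Hz; pose proof (HP z Hz) as Pz.
      destruct (Hin z (proj1 Hz)) as (Z1 & Z2 & Z3).
      destruct (HB z Z1) as [_ Bz].
      assert (Nz : z <> 0%C) by (apply Cmod_gt_0; lra).
      unfold H; rewrite !Cmod_mult, Cmod_pow, Cmod_inv by exact Nz.
      set (r := Cmod z) in *.
      assert (Pn : 0 < r ^ S n) by (apply pow_lt; lra).
      assert (PN : 0 < r ^ N) by (apply pow_lt; lra).
      rewrite pow_inv, pow_add.
      apply Rmult_le_reg_r with (r ^ S n * r ^ N); [apply Rmult_lt_0_compat; assumption|].
      rewrite Rmult_assoc, Rinv_l, Rmult_1_r by (apply Rgt_not_eq, Rmult_lt_0_compat; assumption).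
      set (G := Cmod (g z - partial_sum a n z)).
      assert (HG : 0 <= G) by apply Cmod_ge_0.
      assert (GP : G * Cmod (P z) <= G * (D * (r - 1) ^ 2)) by (apply Rmult_le_compat_l; assumption).
      eapply Rle_trans; [exact GP|].
      destruct (Rtotal_order r 1) as [Hr|[Hr|Hr]].
      + pose proof (power_series_tail_gap a g A e n J z Hg Hr HA HaJ (Rlt_le _ _ He)) as T.
        fold G r in T.
        assert (T2 : G * (D * (r - 1) ^ 2) <= D * (1 - r) * ((e + A * r ^ J) * r ^ S n)).
        { replace (G * (D * (r - 1) ^ 2)) with (D * (1 - r) * (G * (1 - r))) by ring.
          apply Rmult_le_compat_l; [apply Rmult_le_pos; lra|exact T]. }
        eapply Rle_trans; [exact T2|].
        replace (D * (1 - r) * ((e + A * r ^ J) * r ^ S n))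
          with (D * ((1 - r) * (e + A * r ^ J)) * r ^ S n) by ring.
        replace (sigma * (r ^ S n * r ^ N)) with (sigma * r ^ N * r ^ S n) by ring.
        apply Rmult_le_compat_r; [lra|].
        assert (HrN : 1 <= 2 ^ N * r ^ N).
        { rewrite <- Rpow_mult_distr; apply pow_R1_Rle; lra. }
        assert (Dec : INR J * ((1 - r) * r ^ J) <= 1).
        { pose proof (pow_decay r J ltac:(lra)); assert (0 <= r ^ J) by (apply pow_le; lra); lra. }
        assert (DecA : D2 * (A * ((1 - r) * r ^ J)) <= sigma / 2).
        { apply Rmult_le_reg_l with (INR J); [exact HJ0|].
          replace (INR J * (D2 * (A * ((1 - r) * r ^ J)))) with (D2 * A * (INR J * ((1 - r) * r ^ J))) by ring.
          assert (0 <= D2 * A) by (apply Rmult_le_pos; assumption).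
          nra. }
        assert (DecE : D2 * ((1 - r) * e) <= sigma / 2).
        { assert ((1 - r) * e <= e) by nra.
          assert (D2 * ((1 - r) * e) <= D2 * e) by (apply Rmult_le_compat_l; lra). lra. }
        assert (Main : D2 * ((1 - r) * (e + A * r ^ J)) <= sigma) by lra.
        assert (Q : 0 <= D * ((1 - r) * (e + A * r ^ J))).
        { repeat apply Rmult_le_pos; try lra.
          assert (0 <= A * r ^ J) by (apply Rmult_le_pos; [|apply pow_le]; lra). lra. }
        unfold D2 in Main.
        apply Rle_trans with (D * ((1 - r) * (e + A * r ^ J)) * (2 ^ N * r ^ N)).
        * rewrite <- (Rmult_1_r (D * _)) at 1; apply Rmult_le_compat_l; assumption.
        * replace (D * ((1 - r) * (e + A * r ^ J)) * (2 ^ N * r ^ N))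
            with (D * 2 ^ N * ((1 - r) * (e + A * r ^ J)) * r ^ N) by ring.
          apply Rmult_le_compat_r; lra.
      (* At the two crossings themselves the weight vanishes. *)
      + rewrite Hr; replace (G * (D * (1 - 1) ^ 2)) with 0 by ring.
        rewrite !pow1; lra.
      + pose proof (partial_sum_outside a A n z ltac:(fold r; lra) HA) as T; fold r in T.
        assert (HG2 : G <= B + Cmod (partial_sum a n z)).
        { unfold G, Cminus; eapply Rle_trans; [apply Cmod_triangle|]; rewrite Cmod_opp; lra. }
        assert (Rn : 1 <= r ^ S n) by (apply pow_R1_Rle; lra).
        (* The part with [B] uses [r <= 2], so that [r - 1 <= 1 <= r ^ S n]. *)
        assert (T2 : G * (r - 1) <= (A + B) * r ^ S n).
        { apply Rle_trans with (B * (r - 1) + Cmod (partial_sum a n z) * (r - 1)); nra. }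
        pose proof (pow_growth r N ltac:(lra)) as Gr.
        replace (G * (D * (r - 1) ^ 2)) with (D * (r - 1) * (G * (r - 1))) by ring.
        apply Rle_trans with (D * (r - 1) * ((A + B) * r ^ S n)).
        * apply Rmult_le_compat_l; [apply Rmult_le_pos; lra|exact T2].
        * replace (D * (r - 1) * ((A + B) * r ^ S n)) with (D * (A + B) * (r - 1) * r ^ S n) by ring.
          replace (sigma * (r ^ S n * r ^ N)) with (sigma * r ^ N * r ^ S n) by ring.
          apply Rmult_le_compat_r; [lra|].
          apply Rle_trans with (INR N * sigma * (r - 1)).
          -- apply Rmult_le_compat_r; lra.
          -- replace (INR N * sigma * (r - 1)) with (sigma * (INR N * (r - 1))) by ring.
             apply Rmult_le_compat_l; lra. }
  assert (EH : Cmod (H 1%C) = Cmod (partial_sum a n 1 - g 1%C) * Cmod (P 1%C)).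
  { unfold H; rewrite Cpow_inv, Cpow_1_l by (apply Cmod_gt_0; rewrite Cmod_1; lra).
    rewrite !Cmod_mult, Cmod_inv, Cmod_1, Rinv_1, Rmult_1_r, (Cmod_sub_sym (g 1%C))
      by (apply Cmod_gt_0; rewrite Cmod_1; lra).
    reflexivity. }
  apply Rmult_lt_reg_r with (Cmod (P 1%C)); lra.
Qed.

(** * Rotation to an arbitrary point of the circle *)

Lemma partial_sum_rotate (a : nat -> C) (z0 z : C) (n : nat) :
  partial_sum (fun k => a k * z0 ^ k)%C n z = partial_sum a n (z0 * z)%C.
Proof.
  apply sum_n_ext; intros k; rewrite Cpow_mult_l; C_ring.
Qed.

Lemma is_power_series_sum_rotate (a : nat -> C) (g : C -> C) (z0 : C) :
  Cmod z0 = 1 -> is_power_series_sum a g ->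
  is_power_series_sum (fun k => a k * z0 ^ k)%C (fun z => g (z0 * z)%C).
Proof.
  intros Hz0 Hg z Hz.
  apply (is_series_ext (fun k => a k * (z0 * z) ^ k)%C).
  - intros k; rewrite Cpow_mult_l; C_ring.
  - apply Hg; unfold unit_disc in *; rewrite Cmod_mult, Hz0; lra.
Qed.

(** Rotation preserves the moduli of the coefficients. For every [z] on the circle within [d] of
    [zs], the rotated function is differentiable and bounded by [|g zs| + 1] on the same disc around
    1. One pair [e], [J] thus serves all these [z]. *)
Lemma overconvergence_near (a : nat -> C) (g : C -> C) (A : R) (m : nat -> nat) (zs : C) :
  is_power_series_sum a g ->
  (forall k, Cmod (a k) <= A) ->
  (forall e J, 0 < e -> exists V, forall v j, (V <= v)%nat -> (j < J)%nat ->
    Cmod (a (S (m v) + j)%nat) <= e) ->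
  locally (T := C_UniformSpace) zs (C_differentiable g) ->
  exists d, 0 < d /\ forall eps, 0 < eps -> exists V, forall v z, (V <= v)%nat ->
    Cmod z = 1 -> Cmod (z - zs) < d -> Cmod (partial_sum a (m v) z - g z) < eps.
Proof.
  intros Hg HA Hgap Dg.
  pose proof (C_differentiable_continuous _ _ (locally_singleton _ _ Dg)) as Cg.
  apply locally_C in Dg; destruct Dg as (d1 & Hd1 & Dg).
  destruct (proj1 (C_continuous_eps _ _) Cg 1 Rlt_0_1) as (d2 & Hd2 & Bg).
  (* Half is for the distance from [z] to [zs], half for that from [z * w] to [z]. *)
  set (d := Rmin d1 d2 / 2).
  assert (Hd : 0 < d /\ 2 * d <= d1 /\ 2 * d <= d2).
  { unfold d; pose proof (Rmin_l d1 d2); pose proof (Rmin_r d1 d2).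
    assert (0 < Rmin d1 d2) by (apply Rmin_glb_lt; lra); lra. }
  exists d; split; [lra|]; intros eps Heps.
  destruct (local_overconvergence A (Cmod (g zs) + 1) d eps ltac:(lra) Heps) as (e & J & He & Loc).
  destruct (Hgap e J He) as [V HV].
  exists V; intros v z Hv Hz Near.
  assert (Rot : forall k, Cmod (a k * z ^ k) = Cmod (a k))
    by (intros k; rewrite Cmod_mult, Cmod_pow, Hz, pow1; ring).
  specialize (Loc (fun k => a k * z ^ k)%C (fun w => g (z * w)%C) (m v)).
  rewrite partial_sum_rotate in Loc; simpl in Loc; rewrite Cmult_1_r in Loc.
  apply Loc.
  - intros k; rewrite Rot; apply HA.
  - intros j Hj; change (Cmod (a (S (m v) + j)%nat * z ^ (S (m v) + j)) <= e); rewrite Rot.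
    apply HV; assumption.
  - apply is_power_series_sum_rotate; assumption.
  - intros w Hw.
    assert (Nw : Cmod (z * w - zs) < 2 * d).
    { replace (z * w - zs)%C with (z * (w - 1) + (z - zs))%C by ring.
      eapply Rle_lt_trans; [apply Cmod_triangle|]; rewrite Cmod_mult, Hz; lra. }
    split.
    + apply (C_differentiable_comp g (fun w => z * w)%C); [|apply Dg; lra].
      apply C_differentiable_mult; [apply C_differentiable_const|apply C_differentiable_id].
    + replace (g (z * w)%C) with ((g (z * w) - g zs) + g zs)%C by ring.
      eapply Rle_trans; [apply Cmod_triangle|].
      specialize (Bg (z * w)%C ltac:(lra)); lra.
Qed.

(** * Quasi-lacunary sequences and the arc *)

Lemma bounded_of_eventually (u : nat -> R) (N : nat) (M : R) :
  (forall n, (N <= n)%nat -> u n <= M) -> exists M', forall n, u n <= M'.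
Proof.
  revert M; induction N as [|N IH]; intros M H.
  - exists M; intros n; apply H; lia.
  - apply (IH (Rmax M (u N))); intros n Hn.
    destruct (Nat.eq_dec n N) as [->|Hne]; [apply Rmax_r|].
    eapply Rle_trans; [apply H; lia|apply Rmax_l].
Qed.

Lemma p_summable_small (p : R) (c : nat -> C) (e : R) :
  0 < p -> 0 < e -> p_summable p c ->
  exists N, forall j, (N <= j)%nat -> Cmod (c j) <= e.
Proof.
  intros Hp He Hc.
  apply ex_series_lim_0, is_lim_seq_spec in Hc.
  assert (Hep : 0 < Rpower e p) by apply exp_pos.
  destruct (Hc (mkposreal _ Hep)) as [N HN]; simpl in HN.
  exists N; intros j Hj; apply Rnot_lt_le; intros Hlt.
  specialize (HN j Hj); unfold nnpow in HN.
  destruct (Req_EM_T (Cmod (c j)) 0) as [E|_]; [lra|].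
  rewrite Rminus_0_r, Rabs_pos_eq in HN by (left; apply exp_pos).
  assert (Rpower e p <= Rpower (Cmod (c j)) p) by (apply Rle_Rpower_l; lra).
  lra.
Qed.

Section QuasiLacunary.

Variables (a : nat -> C) (m : nat -> nat).
Hypothesis quasi_lac : quasi_lacunary a m.

Lemma quasi_lacunary_gap (J : nat) : exists V, forall v, (V <= v)%nat -> (m v + J < m (S v))%nat.
Proof.
  destruct quasi_lac as (_ & Hlim & _).
  apply is_lim_seq_spec in Hlim; destruct (Hlim (INR J)) as [V HV].
  exists V; intros v Hv; specialize (HV v Hv).
  apply INR_lt; rewrite plus_INR; lra.
Qed.

Lemma quasi_lacunary_index_unbounded (N : nat) : exists V, forall v, (V <= v)%nat -> (N <= m v)%nat.
Proof.
  (* Gap length 0 already makes [m] strictly increasing from [V] on. *)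
  destruct (quasi_lacunary_gap O) as [V HV].
  assert (H : forall k, (k <= m (V + k))%nat).
  { induction k as [|k IH]; [lia|].
    rewrite Nat.add_succ_r; specialize (HV (V + k)%nat ltac:(lia)); lia. }
  exists (V + N)%nat; intros v Hv; specialize (H (v - V)%nat).
  replace (V + (v - V))%nat with v in H by lia; lia.
Qed.

(** Once the gap after [m v] exceeds [J], the indices [m v + 1] to [m v + J] lie strictly inside it,
    where [c] dominates [a]; and [c] tends to 0. *)
Lemma quasi_lacunary_after_index_small (e : R) (J : nat) : 0 < e ->
  exists V, forall v j, (V <= v)%nat -> (j < J)%nat -> Cmod (a (S (m v) + j)%nat) <= e.
Proof.
  intros He.
  destruct (quasi_lacunary_gap J) as [V1 HV1].
  destruct quasi_lac as (_ & _ & p & c & Hp & Hc & Hac).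
  destruct (p_summable_small p c e ltac:(lra) He Hc) as [N HN].
  destruct (quasi_lacunary_index_unbounded N) as [V2 HV2].
  exists (V1 + V2)%nat; intros v j Hv Hj.
  specialize (HV1 v ltac:(lia)); specialize (HV2 v ltac:(lia)).
  eapply Rle_trans; [apply (Hac v); lia|apply HN; lia].
Qed.

(** From [m O] on, an index either is some [m v] or lies strictly inside a gap; only finitely many
    indices precede [m O]. *)
Lemma quasi_lacunary_bounded :
  (exists M, forall v, Cmod (a (m v)) <= M) -> exists A, forall k, Cmod (a k) <= A.
Proof.
  intros [M HM].
  destruct quasi_lac as (_ & _ & p & c & Hp & Hc & Hac).
  destruct (p_summable_small p c 1 ltac:(lra) Rlt_0_1 Hc) as [N HN].
  destruct (bounded_of_eventually (fun j => Cmod (c j)) N 1 HN) as [M' HM'].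
  assert (Hv : forall v k, (m O <= k <= m v)%nat -> Cmod (a k) <= Rmax M M').
  { induction v as [|v IH]; intros k Hk.
    - replace k with (m O) by lia; eapply Rle_trans; [apply HM|apply Rmax_l].
    - destruct (Nat.le_gt_cases k (m v)) as [L|L]; [apply IH; lia|].
      destruct (Nat.eq_dec k (m (S v))) as [->|Ne].
      + eapply Rle_trans; [apply HM|apply Rmax_l].
      + eapply Rle_trans; [apply (Hac v); lia|].
        eapply Rle_trans; [apply HM'|apply Rmax_r]. }
  apply (bounded_of_eventually (fun k => Cmod (a k)) (m O) (Rmax M M')).
  intros k Hk; destruct (quasi_lacunary_index_unbounded k) as [V HV].
  apply (Hv V); specialize (HV V (Nat.le_refl V)); lia.
Qed.

End QuasiLacunary.

(* Taking the gauge [delta t] below [1 / V t] lets a single compactness argument produce both the covering and a common threshold. *)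
Lemma uniform_threshold_on_interval (alpha beta : R) (Q : nat -> R -> Prop) :
  (forall t, alpha <= t <= beta -> exists d V, 0 < d /\
    forall v x, (V <= v)%nat -> Rabs (x - t) < d -> Q v x) ->
  exists V, forall v x, (V <= v)%nat -> alpha <= x <= beta -> Q v x.
Proof.
  intros H.
  assert (G : forall t, exists delta : posreal, alpha <= t <= beta ->
    forall v x, / delta <= INR v -> Rabs (x - t) < delta -> Q v x).
  { intros t; destruct (Rle_dec alpha t) as [H1|H1]; [|exists (mkposreal 1 Rlt_0_1); lra].
    destruct (Rle_dec t beta) as [H2|H2]; [|exists (mkposreal 1 Rlt_0_1); lra].
    destruct (H t (conj H1 H2)) as (d & V & Hd & HQ).
    assert (HV : 0 < INR V + 1) by (pose proof (pos_INR V); lra).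
    assert (Hm : 0 < Rmin d (/ (INR V + 1)))
      by (apply Rmin_glb_lt; [exact Hd|apply Rinv_0_lt_compat, HV]).
    exists (mkposreal _ Hm); intros _ v x Hv Hx; simpl in Hv, Hx.
    apply HQ; [|pose proof (Rmin_l d (/ (INR V + 1))); lra].
    apply INR_le.
    assert (/ / (INR V + 1) <= / Rmin d (/ (INR V + 1)))
      by (apply Rinv_le_contravar; [exact Hm|apply Rmin_r]).
    rewrite Rinv_inv in *; lra. }
  (* The compactness lemma takes the gauge as a function, which is obtained by choice. *)
  set (delta := fun t => proj1_sig (constructive_indefinite_description _ (G t))).
  assert (Hdelta : forall t, alpha <= t <= beta ->
    forall v x, / delta t <= INR v -> Rabs (x - t) < delta t -> Q v x)
    by (intros t; exact (proj2_sig (constructive_indefinite_description _ (G t)))).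
  destruct (compactness_value_1d alpha beta delta) as [d Hd].
  destruct (INR_unbounded (/ d)) as [V HV].
  exists V; intros v x Hv Hx.
  (* Compactness yields the centre [t] only under a double negation. *)
  apply NNPP; intros NQ; apply (Hd x Hx); intros (t & Ht & Hxt & Hdt).
  apply NQ, (Hdelta t Ht); [|exact Hxt].
  apply Rle_trans with (/ d).
  - apply Rinv_le_contravar; [apply cond_pos|exact Hdt].
  - apply le_INR in Hv; lra.
Qed.

Lemma Cmod_cos_sin (t : R) : Cmod (cos t, sin t) = 1.
Proof.
  unfold Cmod; simpl; rewrite !Rmult_1_r.
  pose proof (sin2_cos2 t) as E; unfold Rsqr in E.
  replace (cos t * cos t + sin t * sin t) with 1 by lra; apply sqrt_1.
Qed.

Lemma cos_sin_continuous (t : R) (d : R) : 0 < d ->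
  exists d', 0 < d' /\ forall x, Rabs (x - t) < d' -> Cmod ((cos x, sin x) - (cos t, sin t))%C < d.
Proof.
  intros Hd.
  assert (Hd2 : 0 < d / 2) by lra.
  destruct (continuous_cos t _ (locally_ball (cos t) (mkposreal _ Hd2))) as [d1 H1].
  destruct (continuous_sin t _ (locally_ball (sin t) (mkposreal _ Hd2))) as [d2 H2].
  exists (Rmin d1 d2); split; [apply Rmin_glb_lt; apply cond_pos|].
  intros x Hx; eapply Rle_lt_trans; [apply Cmod_le_sum_components|]; simpl.
  specialize (H1 x (Rlt_le_trans _ _ _ Hx (Rmin_l _ _))).
  specialize (H2 x (Rlt_le_trans _ _ _ Hx (Rmin_r _ _))).
  change (Rabs (cos x - cos t) < d / 2) in H1.
  change (Rabs (sin x - sin t) < d / 2) in H2.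
  unfold Rminus in *; lra.
Qed.

Theorem theorem3p3 (a : nat -> C) (m : nat -> nat) (f : C -> C)
  (f_sum : is_power_series_sum a f)
  (a_m_quasi_lacunary : quasi_lacunary a m)
  (a_m_bounded : exists M : R, forall v : nat, Cmod (a (m v)) <= M)
  (L : C -> Prop) (L_holomorphy : arc_of_holomorphy f L) :
  converges_uniformly_on L (fun v => partial_sum a (m v)).
Proof.
  destruct L_holomorphy as [(alpha & beta & _ & HL) (U & g & HU & [Uopen Dg] & gf)].
  destruct (quasi_lacunary_bounded a m a_m_quasi_lacunary a_m_bounded) as [A HA].
  (* Outside the disc [f] is arbitrary; its extension [g] replaces it and is the uniform limit on
     the arc. *)
  assert (g_sum : is_power_series_sum a g)
    by (intros z Hz; rewrite gf by exact Hz; apply f_sum, Hz).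
  exists g; intros eps Heps.
  destruct (uniform_threshold_on_interval alpha beta
    (fun v t => Cmod (partial_sum a (m v) (cos t, sin t) - g (cos t, sin t)) < eps)) as [N HN].
  - intros t Ht.
    destruct (overconvergence_near a g A m (cos t, sin t)) as (d & Hd & Hloc); try assumption.
    + apply quasi_lacunary_after_index_small, a_m_quasi_lacunary.
    + assert (Ut : U (cos t, sin t)) by (apply HU; right; apply HL; exists t; auto).
      generalize (Uopen _ Ut); apply (filter_imp (F := locally (T := C_UniformSpace) _)).
      intros z Hz; apply ex_derive_C_differentiable, Dg, Hz.
    + destruct (Hloc eps Heps) as [V HV].
      destruct (cos_sin_continuous t d Hd) as (d' & Hd' & Hcs).
      exists d', V; split; [exact Hd'|].
      intros v x Hv Hx; apply HV; [exact Hv|apply Cmod_cos_sin|apply Hcs, Hx].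
  - exists N; intros v Hv z Hz.
    apply HL in Hz; destruct Hz as (t & Ht & ->); exact (HN v t Hv Ht).
Qed.
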